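(* Let $k\geq 3$ be an odd integer. Let $\mu=\sum_{\lambda\in\Lambda}a(\lambda)\delta_\lambda$ be a measure on $\mathbb{R}^k$ whose support $\Lambda$ is a locally finite set. Suppose that $\mu$ is a temperate distribution, and that its Fourier transform $\widehat{\mu}=\sum_{s\in S}b(s)\delta_s$ is also a measure, supported on a locally finite set $S\subset\mathbb{R}^k$. (The sets $\Lambda$ and $S$ may contain the origin; if $0\notin\Lambda$ put $a(0)=0$, and if $0\notin S$ put $b(0)=0$.) Then $$\sigma=-2a(0)\,\delta'_0+\sum_{\lambda\in\Lambda\setminus\{0\}}\frac{a(\lambda)}{|\lambda|}\big(\delta_{|\lambda|}-\delta_{-|\lambda|}\big)$$ is a temperate distribution on $\mathbb{R}$ whose one-dimensional Fourier transform is $$\widehat{\sigma}=2i\,b(0)\,\alpha_k\,\delta_0^{(k-2)}-i\sum_{s\in S\setminus\{0\}}\frac{b(s)}{|s|^{k-2}}\Big[\sum_{j=0}^{(k-3)/2}\beta_{j,k}\,|s|^j\Big((-1)^j\,\delta^{(j)}_{|s|}-\delta^{(j)}_{-|s|}\Big)\Big],$$ where $$\alpha_k=\frac{(-1)^{(k-3)/2}}{(k-2)!!}\Big(\frac{1}{2\pi}\Big)^{(k-3)/2},\qquad \beta_{j,k}=\frac{(-1)^j\,(k-j-3)!}{j!\,(k-2j-3)!!}\Big(\frac{1}{2\pi}\Big)^{(k-3)/2}\quad (0\leq j\leq (k-3)/2).$$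
   Context: A set is locally finite if it has no finite accumulation points. The coefficients $a(\lambda),b(s)$ are complex, $|\cdot|$ is the Euclidean norm, and $\delta_x$ is the unit mass at $x$; $\delta_x^{(j)}$ is its $j$-th distributional derivative, $\langle\delta_x^{(j)},\varphi\rangle=(-1)^j\varphi^{(j)}(x)$. A temperate distribution is a distribution (continuous linear functional on the space of infinitely smooth compactly supported functions) that extends to a continuous linear functional on the Schwartz space. Infinite sums of distributions supported on a locally finite set are understood via their action on compactly supported smooth test functions. The Fourier transform of a Schwartz function on $\mathbb{R}^k$ is $\widehat{\varphi}(\xi)=\int_{\mathbb{R}^k}\varphi(x)e^{-2\pi i\langle\xi,x\rangle}\,dx$, and that of a temperate distribution is defined by $\langle\widehat{\sigma},\varphi\rangle=\langle\sigma,\widehat{\varphi}\rangle$ (bilinear pairing, no conjugation). The double factorial is $n!!=n(n-2)(n-4)\cdots$ (ending in $1$ or $2$), with $0!!=1$. *)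

(* Defs.v *)
From HB Require Import structures.
From mathcomp Require Import all_boot all_order all_algebra.
From mathcomp Require Import all_classical all_reals all_analysis.
From mathcomp Require Export complex.

Set Implicit Arguments.
Unset Strict Implicit.
Unset Printing Implicit Defensive.

Import Order.TTheory GRing.Theory Num.Theory.
Import numFieldNormedType.Exports.

Local Open Scope classical_set_scope.
Local Open Scope ring_scope.
Local Open Scope complex_scope.

(* R^n is 'rV[R]_n. The norm that the library puts on it is the sup norm, which
   gives the right topology; the Euclidean norm is enorm. *)
Section EuclideanSpace.
Context {R : realType} {n : nat}.
Implicit Types x y : 'rV[R]_n.

Definition dotp x y : R := \sum_(i < n) x 0 i * y 0 i.

Definition enorm x : R := Num.sqrt (dotp x x).

Definition locally_finite (A : set 'rV[R]_n) := limit_point A = set0.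

End EuclideanSpace.

(* Modulus with values in R; the norm `|z| of R[i] takes its values in R[i]. *)
Definition cmod {R : realType} (z : R[i]) : R :=
  Num.sqrt (complex.Re z ^+ 2 + complex.Im z ^+ 2).

Definition re_part {R : Type} {T : Type} (phi : T -> R[i]) (x : T) : R :=
  complex.Re (phi x).

Definition im_part {R : Type} {T : Type} (phi : T -> R[i]) (x : T) : R :=
  complex.Im (phi x).

Section SmoothFunctions.
Context {R : realType} {n : nat}.
Implicit Types (f g : 'rV[R]_n -> R) (phi psi : 'rV[R]_n -> R[i]).

(* Iterated partial derivative along the list of coordinates l; the order of
   differentiation is size l. *)
Definition pderiv (l : seq 'I_n) f : 'rV[R]_n -> R :=
  foldr (fun i g => 'D_(delta_mx 0 i) g) f l.

Definition real_smooth f := forall l : seq 'I_n,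
  continuous (pderiv l f) /\
  (forall i x, derivable (pderiv l f) x (delta_mx 0 i)).

Definition cpderiv (l : seq 'I_n) phi (x : 'rV[R]_n) : R[i] :=
  pderiv l (re_part phi) x +i* pderiv l (im_part phi) x.

Definition smooth phi :=
  real_smooth (re_part phi) /\ real_smooth (im_part phi).

Definition fsupp phi : set 'rV[R]_n := closure [set x | phi x != 0].

Definition test_function phi := smooth phi /\ compact (fsupp phi).

(* M is an upper bound of sup_x |D^l phi(x)| for all orders |l| <= N. *)
Definition test_bound (N : nat) phi (M : R) :=
  forall l x, (size l <= N)%N -> cmod (cpderiv l phi x) <= M.

(* M is an upper bound of sup_x (1 + |x|)^N |D^l phi(x)| for all |l| <= N. *)
Definition schwartz_bound (N : nat) phi (M : R) :=
  forall l x, (size l <= N)%N -> (1 + enorm x) ^+ N * cmod (cpderiv l phi x) <= M.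

Definition schwartz phi :=
  smooth phi /\ forall N, exists M, schwartz_bound N phi M.

End SmoothFunctions.

(* Functionals are total on functions R^n -> C; only their values on test
   functions (resp. Schwartz functions) matter. Continuity is expressed, as in
   Hormander, by an estimate through finitely many of the seminorms defining the
   topology (on each compact set, in the case of test functions). *)
Section Distributions.
Context {R : realType} {n : nat}.
Local Notation functional := (('rV[R]_n -> R[i]) -> R[i]).
Implicit Types u v T : functional.

Definition linear_on (D : set ('rV[R]_n -> R[i])) u :=
  forall (c : R[i]) phi psi, D phi -> D psi ->
    u (fun x => c * phi x + psi x) = c * u phi + u psi.

Definition distribution u :=
  linear_on test_function u /\
  forall K : set 'rV[R]_n, compact K -> exists (N : nat) (C : R),
    forall phi M, test_function phi -> fsupp phi `<=` K ->
      test_bound N phi M -> cmod (u phi) <= C * M.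

Definition schwartz_functional T :=
  linear_on schwartz T /\
  exists (N : nat) (C : R), forall phi M,
    schwartz phi -> schwartz_bound N phi M -> cmod (T phi) <= C * M.

(* Test functions are dense in the Schwartz space, so there is at most one such
   T up to its values outside the Schwartz space. *)
Definition temperate_extension u T :=
  schwartz_functional T /\ (forall phi, test_function phi -> T phi = u phi).

Definition temperate u := distribution u /\ exists T, temperate_extension u T.

End Distributions.

(* Iterated Lebesgue integral over R^n, first coordinate outermost. It is only
   used for Schwartz functions, for which it is the Lebesgue integral on R^n by
   Fubini's theorem. *)
Fixpoint real_integral {R : realType} (n : nat) : ('rV[R]_n -> R) -> R :=
  match n return ('rV[R]_n -> R) -> R with
  | 0%N => fun f => f 0
  | m.+1 => fun f =>
      \int[lebesgue_measure]_t
        real_integral (fun y : 'rV[R]_m => f (row_mx (const_mx t : 'rV[R]_1) y))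
  end.

Section Fourier.
Context {R : realType} {n : nat}.
Implicit Types (phi : 'rV[R]_n -> R[i]) (u v : ('rV[R]_n -> R[i]) -> R[i]).

Definition cintegral phi : R[i] :=
  real_integral (re_part phi) +i* real_integral (im_part phi).

Definition expi (t : R) : R[i] := cos t +i* sin t.

Definition fourier phi (xi : 'rV[R]_n) : R[i] :=
  cintegral (fun x => phi x * expi (- (2 * pi * dotp xi x))).

(* u is temperate and its Fourier transform is the distribution v. *)
Definition fourier_transform u v :=
  distribution u /\ distribution v /\
  exists2 T, temperate_extension u T &
    forall phi, test_function phi -> v phi = T (fourier phi).

(* The measure \sum_(x in A) c x delta_x. When A is locally finite and phi is a
   test function, the sum has finitely many nonzero terms. *)
Definition atomic_measure (A : set 'rV[R]_n) (c : 'rV[R]_n -> R[i]) phi : R[i] :=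
  \sum_(x \in A) c x * phi x.

End Fourier.

(* The j-th derivative of the unit mass at the point t of R = 'rV[R]_1. *)
Definition ddelta {R : realType} (j : nat) (t : R) (phi : 'rV[R]_1 -> R[i]) : R[i] :=
  (-1) ^+ j * cpderiv (nseq j ord0) phi (const_mx t).

Fixpoint dfact (n : nat) : nat :=
  match n with
  | m.+2 => (n * dfact m)%N
  | _ => 1%N
  end.

Section GuinandSums.
Context {R : realType} (k : nat).
Implicit Types (A : set 'rV[R]_k) (c : 'rV[R]_k -> R[i]) (phi : 'rV[R]_1 -> R[i]).

Definition alpha : R :=
  (-1) ^+ (k - 3)./2 / (dfact (k - 2))%:R * (1 / (2 * pi)) ^+ (k - 3)./2.

Definition beta (j : nat) : R :=
  (-1) ^+ j * (k - j - 3)`!%:R / (j`!%:R * (dfact (k - 2 * j - 3))%:R)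
  * (1 / (2 * pi)) ^+ (k - 3)./2.

Definition sigma A c phi : R[i] :=
  - 2 * c 0 * ddelta 1 0 phi
  + \sum_(x \in A `\ 0) c x / (enorm x)%:C
      * (ddelta 0 (enorm x) phi - ddelta 0 (- enorm x) phi).

Definition sigma_hat A c phi : R[i] :=
  2 * 'i%C * c 0 * alpha%:C * ddelta (k - 2) 0 phi
  - 'i%C * \sum_(s \in A `\ 0) c s / (enorm s)%:C ^+ (k - 2)
      * (\sum_(0 <= j < (k - 3)./2.+1) (beta j)%:C * (enorm s)%:C ^+ j
           * ((-1) ^+ j * ddelta j (enorm s) phi - ddelta j (- enorm s) phi)).

End GuinandSums.

(* Main.v *)
Require Import Defs.
From mathcomp Require Import all_boot all_order all_algebra.
From mathcomp Require Import all_classical all_reals all_analysis.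
From mathcomp Require Import ring lra zify measurable_realfun.
Import Order.TTheory GRing.Theory Num.Theory.
Import numFieldNormedType.Exports.
Set Implicit Arguments.
Unset Strict Implicit.
Unset Printing Implicit Defensive.
Local Open Scope classical_set_scope.
Local Open Scope ring_scope.
Local Open Scope complex_scope.

(** Both distributions on the line are pulled back from R^k along a map that
    sends a function phi on R to a radial function on R^k:

      <sigma, phi> = <mu, odd_lift phi>,
      <sigma_hat, phi> = <mu_hat, spectral_lift phi>.

    Here odd_lift phi x = (phi |x| - phi (- |x|)) / |x|, whose value 2 phi'(0)
    at the origin accounts for the term in delta'_0, and spectral_lift phi is
    the function read off from the coefficients alpha and beta. Everything
    follows once the two lifts are known to be linear and continuous and to be
    exchanged by the Fourier transform: for phi in the space of test functions,

      fourier (spectral_lift phi) = odd_lift (fourier phi)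

    (fourier_spectral_lift). If T extends mu to the Schwartz space, then
    T o odd_lift extends sigma, and <sigma_hat, phi> =
    T (fourier (spectral_lift phi)) = T (odd_lift (fourier phi)).

    For the identity, write k = 2p + 3 and let D be the operator
    - 1/(2 pi r) d/dr on even functions of r. An induction on p expands
    D^p applied to (phi(r) - phi(-r)) / r in the derivatives of phi at r and
    at -r; the coefficients turn out to be the beta_{j,k}, and the value at
    r = 0 produces alpha_k (iter_radial_quotE, iter_radial_quot0,
    spectral_liftE). Thus, if P is the even compactly supported primitive of
    phi(t) - phi(-t), then spectral_lift phi is 2 pi i times D^(p+1) P (|x|).

    Fundamental to the computation is that D is undone by an integral over a
    plane: the integral of (D f)(sqrt (r^2 + s^2 + t^2)) ds dt is f(r), as polar
    coordinates show (abel_abel, abel_abel_descent). Since the Fourier kernel of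
    frequency xi may be rotated so as to depend on one coordinate only
    (wave_rotation, real_integral_wave), integrating a radial function of x in
    R^k over the remaining 2p + 2 coordinates reduces its Fourier transform at
    xi to a one-dimensional one at |xi|. For D^(p+1) P it is therefore the
    cosine transform of P at |xi|; an integration by parts turns this
    into the sine transform of phi divided by |xi| (cosint_primitive), which is
    the difference quotient of fourier phi.

    Continuity is a matter of dividing by r. A smooth function is carried along
    with the sequence of its derivatives, and the quotient (g(r) - g(0)) / r is
    the integral of g'(t r) over t in [0, 1] (jet_quot), which is smooth and is
    bounded in weighted sup norms by those of g (jet_bound_quot). The partial
    derivative of a radial function F(|x|) in the i-th coordinate is
    x_i times the radial function of F'(r)/r, so all seminorms of a radial
    function on R^k reduce to estimates on the line (radial_bound). *)

(** * One-variable calculus *)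

Section RealDerivatives.
Context {R : realType}.
Implicit Types (f g : R -> R) (x : R).

Lemma is_derive_cst_fun (c x : R) : is_derive x 1 (fun=> c) (0 : R).
Proof. exact: is_derive_cst. Qed.

Lemma is_derive_id_fun x : is_derive x 1 (fun y : R => y) (1 : R).
Proof. exact: is_derive_id. Qed.

Lemma is_derive_add f g x (a b : R) : is_derive x 1 f a -> is_derive x 1 g b ->
  is_derive x 1 (fun y => f y + g y) (a + b).
Proof. exact: is_deriveD. Qed.

Lemma is_derive_mul f g x (a b : R) : is_derive x 1 f a -> is_derive x 1 g b ->
  is_derive x 1 (fun y => f y * g y) (f x * b + g x * a).
Proof. exact: is_deriveM. Qed.

Lemma is_derive_scale f x (k a : R) : is_derive x 1 f a ->
  is_derive x 1 (fun y => k * f y) (k * a).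
Proof. exact: is_deriveZ. Qed.

Lemma is_derive_opp f x (a : R) : is_derive x 1 f a ->
  is_derive x 1 (fun y => - f y) (- a).
Proof. exact: is_deriveN. Qed.

Lemma is_derive_comp f g x (a b : R) : is_derive (g x) 1 f a ->
  is_derive x 1 g b -> is_derive x 1 (fun y => f (g y)) (a * b).
Proof. exact: is_derive1_comp. Qed.

Lemma is_derive_affine (c d x : R) : is_derive x 1 (fun y : R => c * y + d) c.
Proof.
have := is_derive_add (is_derive_scale c (is_derive_id_fun x)) (is_derive_cst_fun d x).
by rewrite mulr1 addr0.
Qed.

Lemma is_derive_comp_affine f x (c d a : R) : is_derive (c * x + d) 1 f a ->
  is_derive x 1 (fun y => f (c * y + d)) (c * a).
Proof.
by move=> df; rewrite mulrC; apply: is_derive_comp => //; exact: is_derive_affine.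
Qed.

Lemma is_derive_continuous_at f x (a : R) : is_derive x 1 f a ->
  {for x, continuous f}.
Proof.
by case=> df _; apply: differentiable_continuous; apply/derivable1_diffP.
Qed.

Lemma is_derive_continuous f (f' : R -> R) :
  (forall x, is_derive x 1 f (f' x)) -> continuous f.
Proof. by move=> df x; apply: is_derive_continuous_at (df x). Qed.

Lemma is_derive_unique f x (a b : R) : is_derive x 1 f a -> is_derive x 1 f b ->
  a = b.
Proof. by move=> [_ <-] [_ <-]. Qed.

End RealDerivatives.

(** * Integrals of functions that vanish outside an interval *)

Section Integration.
Context {R : realType}.
Local Notation mu := (@lebesgue_measure R).
Implicit Types (f g F : R -> R) (a b c d x s t : R).

Definition vanish_out (a b : R) f := forall x, ~~ (a < x < b) -> f x = 0.

Lemma integral_vanish_out a b f : vanish_out a b f ->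
  \int[mu]_x f x = \int[mu]_(x in `[a, b]) f x.
Proof.
move=> f0; rewrite [RHS]Rintegral_mkcond; apply: eq_Rintegral => x _.
rewrite patchE; case: ifPn => // xab; rewrite f0//.
apply: contra xab => /andP[ax xb]; rewrite inE/= in_itv/=.
by rewrite !ltW.
Qed.

Lemma integrable_cont_itv a b f : continuous f ->
  mu.-integrable `[a, b] (EFin \o f).
Proof.
move=> cf; apply: continuous_compact_integrable; first exact: segment_compact.
exact: continuous_subspaceT.
Qed.

Lemma integrable_vanish_out a b f : continuous f -> vanish_out a b f ->
  mu.-integrable setT (EFin \o f).
Proof.
move=> cf f0; have mI : measurable (`[a, b]%classic : set (measurableTypeR R)) by exact: measurable_itv.
have := (integrable_mkcond _ mI).1 (integrable_cont_itv a b cf).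
congr (mu.-integrable _ _).
apply/funext => x; rewrite patchE; case: ifPn => //= xab; rewrite f0//.
apply: contra xab => /andP[ax xb]; rewrite inE/= in_itv/=.
by rewrite !ltW.
Qed.

Lemma integral_itv_primitive a b f F : a < b -> continuous f ->
  (forall x, a < x < b -> is_derive x 1 F (f x)) -> continuous F ->
  \int[mu]_(x in `[a, b]) f x = F b - F a.
Proof.
move=> ab cf dF cF; rewrite /Rintegral (@continuous_FTC2 _ f F)//.
- exact: continuous_subspaceT.
- split=> [x||].
  + by rewrite in_itv/= => /dF[].
  + exact/cvg_at_right_filter/cF.
  + exact/cvg_at_left_filter/cF.
- by move=> x; rewrite in_itv/= => /dF ?; rewrite derive1E derive_val.
Qed.

Lemma integral_primitive a b f F : a < b -> continuous f -> vanish_out a b f ->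
  (forall x, is_derive x 1 F (f x)) ->
  \int[mu]_x f x = F b - F a.
Proof.
move=> ab cf f0 dF; rewrite (integral_vanish_out f0).
by apply: integral_itv_primitive => //; apply: is_derive_continuous dF.
Qed.

Lemma exists_primitive a b f : continuous f -> vanish_out a b f ->
  exists F, forall x, is_derive x 1 F (f x).
Proof.
move=> cf f0; exists (fun x => \int[mu]_(t in [set` `]-oo, x]]) f t) => x.
have [|//|||df f'] := @continuous_FTC1 R f -oo%O x (x + 1).
- by rewrite ltrDl.
- apply: integrableS (integrable_vanish_out cf f0) => //.
- by rewrite ltNyr.
- exact: cf.
- by apply: DeriveDef => //; rewrite -derive1E f'.
Qed.

(** Comparing primitives at the ends of the two intervals suffices, because f
    is continuous with compact support. *)
Lemma integral_affine a b c d f : continuous f -> vanish_out a b f -> c != 0 ->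
  \int[mu]_x (`|c| * f (c * x + d)) = \int[mu]_x f x.
Proof.
move=> cf f0 c0; have [F dF] := exists_primitive cf f0.
wlog ab : a b f0 / a < b.
  move=> h; apply: (h (Num.min a b - 1) (Num.max a b)).
    move=> x xab; apply: f0; apply: contra xab => /andP[ax xb].
    by rewrite (lt_trans _ ax) ?lt_max ?xb ?orbT//= ltrBlDr gt_min ltrDl ltr01.
  apply: (@lt_le_trans _ _ (Num.min a b)); first by rewrite ltrBlDr ltrDl.
  by rewrite ge_min le_max lexx.
rewrite (integral_primitive ab cf f0 dF).
have dG k x : is_derive x 1 (fun x => k * F (c * x + d)) (k * (c * f (c * x + d))).
  by apply: is_derive_scale; apply: is_derive_comp_affine.
have cg : continuous (fun x => `|c| * f (c * x + d)).
  move=> x; apply: cvgM; first exact: cvg_cst.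
  apply: continuous_comp; last exact: cf.
  exact: is_derive_continuous_at (is_derive_affine c d x).
pose u := (a - d) / c; pose v := (b - d) / c.
have uE : c * u + d = a by rewrite /u mulrC divfK// subrK.
have vE : c * v + d = b by rewrite /v mulrC divfK// subrK.
have [cgt0|clt0|ceq0] := ltgtP 0 c; last by rewrite ceq0 eqxx in c0.
- have uv : u < v by rewrite -(ltr_pM2l cgt0) -(ltrD2r d) uE vE.
  have dk x : is_derive x 1 (fun x => 1 * F (c * x + d)) (`|c| * f (c * x + d)).
    by have := dG 1 x; rewrite mul1r gtr0_norm.
  rewrite (integral_primitive uv cg _ dk).
  + by rewrite uE vE !mul1r.
  + move=> x xuv; rewrite f0 ?mulr0//; apply: contra xuv.
    by rewrite -{1}uE -{1}vE !ltrD2r !ltr_pM2l.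
- have uv : v < u by rewrite -(ltr_nM2l clt0) -(ltrD2r d) uE vE.
  have dk x : is_derive x 1 (fun x => -1 * F (c * x + d)) (`|c| * f (c * x + d)).
    by have := dG (-1) x; rewrite mulN1r ltr0_norm ?mulNr.
  rewrite (integral_primitive uv cg _ dk).
  + by rewrite uE vE !mulN1r opprK addrC.
  + move=> x xuv; rewrite f0 ?mulr0//; apply: contra xuv.
    by rewrite -{1}uE -{1}vE !ltrD2r !ltr_nM2l// andbC.
Qed.

Local Notation mR := (measurableTypeR R).

Lemma integrable_bounded_vanish_out a b (M : R) (f : mR -> R) :
  measurable_fun setT f -> (forall x, `|f x| <= M) -> vanish_out a b f ->
  mu.-integrable setT (EFin \o f).
Proof.
move=> mf fM f0; pose K : set mR := `[a, b]%classic.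
have mK : measurable K by exact: measurable_itv.
have muK : (mu K < +oo)%E.
  by rewrite /K lebesgue_measure_itv/= -EFinB; case: ifP => // _; rewrite ltry.
have -> : EFin \o f = (EFin \o f) \_ K.
  apply/funext => x; rewrite patchE; case: ifPn => //= xab; rewrite f0//.
  apply: contra xab => /andP[ax xb]; apply/mem_set; rewrite /K/= in_itv/=.
  by rewrite !ltW.
apply: (integrable_mkcond _ mK).1; apply: measurable_bounded_integrable => //.
- exact: measurable_funS mf.
- exists M; split; first exact: num_real.
  by move=> N MN x _; apply: le_trans (fM x) _; exact: ltW.
Qed.

Section PlaneIntegrals.
Variables (a b M : R) (F : mR * mR -> R).
Hypotheses (mF : measurable_fun setT F) (FM : forall z, `|F z| <= M).
Hypothesis F0 : forall z, ~~ ((a < z.1 < b) && (a < z.2 < b)) -> F z = 0.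

Lemma integrable_plane : (mu \x mu)%E.-integrable setT (EFin \o F).
Proof.
pose K : set mR := `[a, b]%classic.
have mK : measurable K by exact: measurable_itv.
have muK : (mu K < +oo)%E.
  by rewrite /K lebesgue_measure_itv/= -EFinB; case: ifP => // _; rewrite ltry.
have -> : EFin \o F = (EFin \o F) \_ (K `*` K).
  apply/funext => z; rewrite patchE; case: ifPn => //= zK; rewrite F0//.
  apply: contra zK => /andP[/andP[? ?] /andP[? ?]].
  by apply/mem_set; split; rewrite /K/= in_itv/=; apply/andP; split; exact: ltW.
have mKK : measurable (K `*` K) by exact: measurableX.
apply: (integrable_mkcond _ mKK).1; apply: measurable_bounded_integrable => //.
- by rewrite /= product_measure1E// lte_mul_pinfty// ge0_fin_numE.
- exact: measurable_funS mF.
- exists M; split; first exact: num_real.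
  by move=> N MN x _; apply: le_trans (FM x) _; exact: ltW.
Qed.

Lemma integrable_vertical s : mu.-integrable setT (EFin \o (fun t => F (s, t))).
Proof.
apply: (@integrable_bounded_vanish_out a b M) => //.
  by apply: measurableT_comp => //; exact: measurable_pair1.
by move=> t tab; apply: F0; apply: contra tab => /andP[_].
Qed.

Lemma integrable_horizontal t : mu.-integrable setT (EFin \o (fun s => F (s, t))).
Proof.
apply: (@integrable_bounded_vanish_out a b M) => //.
  by apply: measurableT_comp => //; exact: measurable_pair2.
by move=> s sab; apply: F0; apply: contra sab => /andP[].
Qed.

Lemma integrable_vertical_integral :
  mu.-integrable setT (EFin \o (fun s => \int[mu]_t F (s, t))).
Proof.
have := integrable_fubini_F integrable_plane; congr (mu.-integrable _ _).
apply/funext => s; rewrite /= /Rintegral fineK//.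
exact: integrable_fin_num (integrable_vertical s).
Qed.

(** F is bounded and lives on a square, hence is integrable for the product
    measure. *)
Lemma Fubini_vanish_out :
  \int[mu]_s \int[mu]_t F (s, t) = \int[mu]_t \int[mu]_s F (s, t).
Proof.
congr fine.
transitivity (\int[mu]_s \int[mu]_t (F (s, t))%:E)%E.
  apply: eq_integral => s _; rewrite fineK//.
  exact: integrable_fin_num (integrable_vertical s).
transitivity (\int[mu]_t \int[mu]_s (F (s, t))%:E)%E; last first.
  apply: eq_integral => t _; rewrite fineK//.
  exact: integrable_fin_num (integrable_horizontal t).
exact: (Fubini integrable_plane).
Qed.

End PlaneIntegrals.

End Integration.

(** * Integrating a radial function along a line *)

Section Profiles.
Context {R : realType}.
Local Notation mu := (@lebesgue_measure R).
Implicit Types (H G E : R -> R) (A B M q s t u : R).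

Lemma bounded_on_segment a b H : continuous H ->
  exists2 M : R, 0 <= M & forall x, a <= x <= b -> `|H x| <= M.
Proof.
move=> cH; have [ab|ba] := leP a b; last first.
  exists 0 => // x /andP[ax xb]; have := le_lt_trans (le_trans ax xb) ba.
  by rewrite ltxx.
have cn : {within `[a, b], continuous (fun x => `|H x|)}.
  apply: continuous_subspaceT => x.
  by apply: continuous_comp; [exact: cH|exact: norm_continuous].
have [c cab Hc] := EVT_max ab cn.
by exists `|H c| => // x xab; apply: Hc; rewrite in_itv.
Qed.

(** Radial functions of x are written as functions of the square of the norm,
    so that composing with a quadratic form stays polynomial. *)
Definition profile A H := continuous H /\ forall q, A <= q -> H q = 0.

(** The summand 1 makes the bound at least 1, so that its square is at least
    |A| + |q|. *)
Definition cutoff A q : R := 1 + `|A| + `|q|.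

Lemma cutoffP A q s : ~~ (- cutoff A q < s < cutoff A q) -> A <= q + s ^+ 2.
Proof.
move=> sB.
have Bs : cutoff A q <= `|s|.
  by rewrite leNgt; apply: contra sB; rewrite ltr_norml.
have rs : 1 + `|A| + `|q| <= s ^+ 2.
  rewrite -real_normK ?num_real// expr2.
  apply: (le_trans Bs); rewrite ler_peMl//.
  by rewrite (le_trans _ Bs)// /cutoff -addrA lerDl addr_ge0.
have := ler_norm A; have := ler_norm (- q); rewrite normrN.
by move: rs; lra.
Qed.

Lemma profile_bounded A H q0 : profile A H ->
  exists2 M, 0 <= M & forall q, q0 <= q -> `|H q| <= M.
Proof.
move=> [cH H0]; have [M M0 HM] := bounded_on_segment q0 A cH.
exists M => // q q0q; have [qA|/ltW Aq] := leP q A; first by rewrite HM// q0q.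
by rewrite H0// normr0.
Qed.

Lemma continuous_sqr_shift q : continuous (fun s : R => q + s ^+ 2).
Proof.
move=> s; apply: is_derive_continuous_at.
Qed.

Lemma profile_section_continuous A H q : profile A H ->
  continuous (fun s => H (q + s ^+ 2)).
Proof.
move=> [cH _] s; apply: continuous_comp; last exact: cH.
exact: continuous_sqr_shift.
Qed.

Lemma profile_section_vanish A H q0 q : profile A H -> q0 <= q ->
  vanish_out (- cutoff A q0) (cutoff A q0) (fun s => H (q + s ^+ 2)).
Proof.
move=> [_ H0] q0q s /cutoffP As; apply: H0; apply: (le_trans As).
by rewrite lerD2r.
Qed.

Lemma profile_section_integrable A H q : profile A H ->
  mu.-integrable setT (EFin \o (fun s => H (q + s ^+ 2))).
Proof.
move=> HA; apply: integrable_vanish_out (profile_section_vanish HA (lexx q)).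
exact: profile_section_continuous HA.
Qed.

(** Integrating a radial function along one more coordinate axis yields a
    radial function of the remaining coordinates. *)
Definition abel H q := \int[mu]_s H (q + s ^+ 2).

(** Near a given q all integrands live on one common segment, where dominated
    convergence applies with a constant. *)
Lemma profile_abel A H : profile A H -> profile A (abel H).
Proof.
move=> HA; split; last first.
  move=> q Aq; rewrite /abel; under eq_Rintegral.
    move=> s _; rewrite HA.2; last by rewrite (le_trans Aq)// lerDl sqr_ge0.
    over.
  by rewrite Rintegral_cst//= mul0r.
move=> q; pose B := cutoff A (q - 1).
have [M M0 HM] := profile_bounded (q - 1) HA.
have qI : q \in `](q - 1), (q + 1)[%classic.
  by rewrite inE/= in_itv/= ltrBlDr !ltrDl ltr01.
have cB : {for q, continuous (fun l => \int[mu]_(s in `[- B, B]) H (l + s ^+ 2))}.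
  apply: (@continuity_under_integral R _ _ mu _ `[(- B), B]%classic _ (q - 1) (q + 1) _ _ (cst M)) => //.
  - by move=> x _; apply: integrable_cont_itv; exact: profile_section_continuous HA.
  - apply: aeW => s _ x _; apply: continuous_comp; last exact: HA.1.
    exact: is_derive_continuous_at (is_derive_add (is_derive_id_fun x) (is_derive_cst_fun (s ^+ 2) x)).
  - by apply: integrable_cont_itv; exact: cst_continuous.
  - move=> x; rewrite /= in_itv/= => /andP[qx _]; apply: aeW => s _; apply: HM.
    by rewrite (le_trans (ltW qx))// lerDl sqr_ge0.
rewrite /continuous_at in cB *.
have E l : q - 1 < l -> abel H l = \int[mu]_(s in `[- B, B]) H (l + s ^+ 2).
  by move=> ql; apply: integral_vanish_out; apply: profile_section_vanish (ltW ql).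
rewrite E ?ltrBlDr ?ltrDl//; apply: cvg_trans cB; apply: near_eq_cvg.
near=> l; rewrite E//; by near: l; apply: lt_nbhsr; rewrite ltrBlDr ltrDl ltr01.
Unshelve. all: end_near. Qed.

Lemma abel_ext H1 H2 : (forall q, 0 <= q -> H1 q = H2 q) ->
  forall q, 0 <= q -> abel H1 q = abel H2 q.
Proof.
by move=> H12 q q0; apply: eq_Rintegral => s _; rewrite H12// addr_ge0// sqr_ge0.
Qed.

Lemma profile_iter_abel n A H : profile A H -> profile A (iter n abel H).
Proof. by move=> HA; elim: n => //= n; exact: profile_abel. Qed.

End Profiles.

(** * Rotation invariance in a plane *)

Section Waves.
Context {R : realType}.
Local Notation mu := (@lebesgue_measure R).
Local Notation mR := (measurableTypeR R).

(** The real and the imaginary part of a radial function times a plane wave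
    both have this form, with q the squared radius and u the phase. *)
Definition wave (H1 E1 H2 E2 : R -> R) (q u : R) : R := H1 q * E1 u + H2 q * E2 u.

Implicit Types (q s t u c d : R).
Variables (A : R) (H1 H2 E1 E2 : R -> R).
Hypotheses (H1A : profile A H1) (H2A : profile A H2).
Hypotheses (cE1 : continuous E1) (cE2 : continuous E2).

Local Notation W := (wave H1 E1 H2 E2).

Lemma wave_continuous (f g : R -> R) : continuous f -> continuous g ->
  continuous (fun t => W (f t) (g t)).
Proof.
move=> cf cg t; apply: cvgD; apply: cvgM.
- by apply: (@continuous_comp _ _ _ f H1); [exact: cf|exact: H1A.1].
- by apply: (@continuous_comp _ _ _ g E1); [exact: cg|exact: cE1].
- by apply: (@continuous_comp _ _ _ f H2); [exact: cf|exact: H2A.1].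
- by apply: (@continuous_comp _ _ _ g E2); [exact: cg|exact: cE2].
Qed.

Lemma wave_measurable (f g : mR * mR -> R) :
  measurable_fun setT f -> measurable_fun setT g ->
  measurable_fun setT (fun z => W (f z) (g z)).
Proof.
move=> mf mg; apply: measurable_funD; apply: measurable_funM.
- by apply: (measurableT_comp (continuous_measurable_fun H1A.1) mf).
- by apply: (measurableT_comp (continuous_measurable_fun cE1) mg).
- by apply: (measurableT_comp (continuous_measurable_fun H2A.1) mf).
- by apply: (measurableT_comp (continuous_measurable_fun cE2) mg).
Qed.

Lemma wave_vanish q u : A <= q -> W q u = 0.
Proof. by move=> Aq; rewrite /wave H1A.2// H2A.2// !mul0r addr0. Qed.

Lemma wave_bounded q0 B : exists2 M, 0 <= M &
  forall q u, q0 <= q -> - B <= u <= B -> `|W q u| <= M.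
Proof.
have [M1 M10 HM1] := profile_bounded q0 H1A.
have [M2 M20 HM2] := profile_bounded q0 H2A.
have [N1 N10 EN1] := bounded_on_segment (- B) B cE1.
have [N2 N20 EN2] := bounded_on_segment (- B) B cE2.
exists (M1 * N1 + M2 * N2) => [|q u qq0 uB].
  by rewrite addr_ge0// mulr_ge0.
apply: le_trans (ler_normD _ _) _; rewrite !normrM.
by apply: lerD; apply: ler_pM => //; [exact: HM1|exact: EN1|exact: HM2|exact: EN2].
Qed.

Lemma wave_section_vanish q0 q (g : R -> R) : q0 <= q ->
  vanish_out (- cutoff A q0) (cutoff A q0) (fun s => W (q + s ^+ 2) (g s)).
Proof.
move=> q0q s /cutoffP As; apply: wave_vanish; apply: (le_trans As).
by rewrite lerD2r.
Qed.

Let section_integrable A' H q k : profile A' H ->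
  mu.-integrable setT (EFin \o (fun s => H (q + s ^+ 2) * k)).
Proof.
by move=> HA; exact: (integrableZr measurableT k (profile_section_integrable q HA)).
Qed.

Lemma wave_abel q u :
  \int[mu]_s W (q + s ^+ 2) u = wave (abel H1) E1 (abel H2) E2 q u.
Proof.
rewrite /wave RintegralD//=; last 2 first.
- exact: section_integrable H1A.
- exact: section_integrable H2A.
rewrite RintegralZr//; last exact: profile_section_integrable H1A.
by rewrite RintegralZr//; exact: profile_section_integrable H2A.
Qed.

Lemma wave_reflection q c :
  \int[mu]_t W (q + t ^+ 2) (c * t) = \int[mu]_t W (q + t ^+ 2) (`|c| * t).
Proof.
have [c0|c0] := leP 0 c; first by rewrite ger0_norm.
rewrite ltr0_norm//.
have cf : continuous (fun t => W (q + t ^+ 2) (- c * t)).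
  apply: wave_continuous; first exact: continuous_sqr_shift.
  by move=> t; apply: cvgM; [exact: cvg_cst|exact: cvg_id].
have N1 : (-1 : R) != 0 by rewrite oppr_eq0 oner_eq0.
have := integral_affine 0 cf (wave_section_vanish _ (lexx q)) N1.
move=> <-; apply: eq_Rintegral => t _.
by rewrite normrN1 mul1r addr0 mulN1r sqrrN mulrNN.
Qed.

End Waves.

Section Rotation.
Context {R : realType}.
Local Notation mu := (@lebesgue_measure R).
Local Notation mR := (measurableTypeR R).
Implicit Types (q s t u c d : R).
Variables (A : R) (H1 H2 E1 E2 : R -> R).
Hypotheses (H1A : profile A H1) (H2A : profile A H2).
Hypotheses (cE1 : continuous E1) (cE2 : continuous E2).
Local Notation W := (wave H1 E1 H2 E2).

(** With r the length of (c, d), the substitutions s = (r x - c t) / d and then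
    t = (d y + c x) / r amount to the rotation taking (c, d) to (r, 0): the
    quadratic form t^2 + s^2 equals x^2 + ((r t - c x) / d)^2. *)
Lemma wave_rotation q c d :
  \int[mu]_t \int[mu]_s W (q + t ^+ 2 + s ^+ 2) (c * t + d * s) =
  \int[mu]_t \int[mu]_s W (q + t ^+ 2 + s ^+ 2) (Num.sqrt (c ^+ 2 + d ^+ 2) * t).
Proof.
set r := Num.sqrt _.
have r2 : r ^+ 2 = c ^+ 2 + d ^+ 2 by rewrite sqr_sqrtr// addr_ge0// sqr_ge0.
have [d0|dN0] := eqVneq d 0.
  have -> : r = `|c| by rewrite /r d0 expr0n/= addr0 sqrtr_sqr.
  transitivity (\int[mu]_t wave (abel H1) E1 (abel H2) E2 (q + t ^+ 2) (c * t)).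
    apply: eq_Rintegral => t _; rewrite -(wave_abel E1 E2 H1A H2A).
    by apply: eq_Rintegral => s _; rewrite d0 mul0r addr0.
  rewrite (wave_reflection (profile_abel H1A) (profile_abel H2A) cE1 cE2).
  by apply: eq_Rintegral => t _; rewrite -(wave_abel E1 E2 H1A H2A).
have rN0 : r != 0.
  rewrite -sqrf_eq0 r2 paddr_eq0 ?sqr_ge0// negb_and orbC sqrf_eq0.
  by rewrite dN0.
pose e := r / d; have eN0 : e != 0 by rewrite mulf_neq0// invr_eq0.
pose G (z : mR * mR) : R :=
  `|e| * W (q + z.1 ^+ 2 + (e * z.2 - c / d * z.1) ^+ 2) (r * z.2).
have e2 : e ^+ 2 = 1 + (c / d) ^+ 2.
  by rewrite exprMn r2 expr_div_n mulrDl exprVn addrC mulfV// sqrf_eq0.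
have form t x : q + t ^+ 2 + (e * x - c / d * t) ^+ 2 =
                q + x ^+ 2 + (e * t - c / d * x) ^+ 2.
  have ex (u v w : R) : q + u ^+ 2 + (e * v - w * u) ^+ 2 =
     q + u ^+ 2 + e ^+ 2 * v ^+ 2 - 2 * e * w * u * v + w ^+ 2 * u ^+ 2 by ring.
  by rewrite !ex e2; ring.
pose B := cutoff A q.
have [M M0 WM] := wave_bounded H1A H2A cE1 cE2 q (r * B).
have GE t x : G (t, x) = `|e| * W (q + x ^+ 2 + (e * t - c / d * x) ^+ 2) (r * x).
  by rewrite /G/= form.
have cW f g : continuous f -> continuous g -> continuous (fun t => W (f t) (g t)).
  exact: wave_continuous H1A H2A cE1 cE2 f g.
have vW q0 q1 g : q0 <= q1 -> vanish_out (- cutoff A q0) (cutoff A q0) (fun s => W (q1 + s ^+ 2) (g s)).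
  exact: (@wave_section_vanish _ A H1 H2 E1 E2 H1A H2A q0 q1 g).
have lin (u v : R) : continuous (fun t : R => u * t + v).
  by move=> t; exact: is_derive_continuous_at (is_derive_affine u v t).
transitivity (\int[mu]_t \int[mu]_x G (t, x)).
  apply: eq_Rintegral => t _.
  pose f s := W (q + t ^+ 2 + s ^+ 2) (c * t + d * s).
  have cf : continuous f.
    apply: cW; first exact: continuous_sqr_shift.
    by move=> s; rewrite (_ : (fun _ => _) = (fun s => d * s + c * t)); [exact: lin|apply/funext => z; rewrite addrC].
  rewrite -/f -(integral_affine (- (c / d * t)) cf (vW _ _ (fun s => c * t + d * s) (lexx _)) eN0).
  apply: eq_Rintegral => x _; rewrite /G /f/=; congr (_ * W _ _).
  by rewrite /e; field.
rewrite (@Fubini_vanish_out R (- B) B (`|e| * M) G)//.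
- apply: eq_Rintegral => x _.
  pose f s := W (q + x ^+ 2 + s ^+ 2) (r * x).
  have cf : continuous f.
    apply: cW; [exact: continuous_sqr_shift|exact: cst_continuous].
  rewrite -/f -(integral_affine (- (c / d * x)) cf (vW _ _ (fun s => r * x) (lexx _)) eN0).
  by apply: eq_Rintegral => t _; rewrite GE /f.
- apply: measurable_funM => //.
  apply: (wave_measurable H1A H2A cE1 cE2).
    apply: measurable_funD.
      by apply: measurable_funD => //; apply: measurable_funX; exact: measurable_fst.
    apply: measurable_funX; apply: measurable_funB; apply: measurable_funM => //.
  by apply: measurable_funM => //; exact: measurable_snd.
- move=> [t x]; have [xB|xB] := boolP (- B < x < B).
    rewrite /G/= normrM normr_id ler_wpM2l//; apply: WM.
      by rewrite -addrA lerDl addr_ge0// sqr_ge0.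
    move: xB => /andP[Bx xB]; rewrite -mulrN !ler_wpM2l ?sqrtr_ge0//; exact: ltW.
  rewrite GE (wave_vanish _ _ H1A H2A) ?mulr0 ?normr0 ?mulr_ge0//.
  by apply: (le_trans (cutoffP xB)); rewrite lerDl sqr_ge0.
- move=> [t x] /=; rewrite negb_and => /orP[tB|xB].
    rewrite /G/= (wave_vanish _ _ H1A H2A) ?mulr0//.
    by apply: (le_trans (cutoffP tB)); rewrite lerDl sqr_ge0.
  rewrite GE (wave_vanish _ _ H1A H2A) ?mulr0//.
  by apply: (le_trans (cutoffP xB)); rewrite lerDl sqr_ge0.
Qed.

End Rotation.

(** * A radial function times a plane wave *)

Section RadialIntegrals.
Context {R : realType}.
Local Notation mu := (@lebesgue_measure R).

Lemma real_integralS n (f : 'rV[R]_n.+1 -> R) :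
  real_integral f =
  \int[mu]_t real_integral (fun y : 'rV[R]_n => f (row_mx (const_mx t : 'rV_1) y)).
Proof. by []. Qed.

Lemma dotp_row_mx n (s t : R) (x y : 'rV[R]_n) :
  dotp (row_mx (const_mx s : 'rV_1) x) (row_mx (const_mx t : 'rV_1) y) =
  s * t + dotp x y.
Proof.
rewrite /dotp big_split_ord/= big_ord1 !row_mxEl !mxE; congr (_ + _).
by apply: eq_bigr => i _; rewrite !row_mxEr.
Qed.

Lemma row_mx_split n (x : 'rV[R]_(1 + n)) :
  exists s (y : 'rV[R]_n), x = row_mx (const_mx s : 'rV_1) y.
Proof.
exists (x 0 0), (rsubmx x); rewrite -[LHS]hsubmxK; congr row_mx.
apply/rowP => i; rewrite !mxE ord1; congr (x _ _); exact/val_inj.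
Qed.

Lemma dotp_ge0 n (x : 'rV[R]_n) : 0 <= dotp x x.
Proof. by apply: sumr_ge0 => i _; rewrite -expr2 sqr_ge0. Qed.

Lemma enorm_sqr n (x : 'rV[R]_n) : enorm x ^+ 2 = dotp x x.
Proof. by rewrite sqr_sqrtr// dotp_ge0. Qed.

Lemma continuous_translate (k : R) (E : R -> R) : continuous E ->
  continuous (fun u => E (k + u)).
Proof.
move=> cE u; apply: (@continuous_comp _ _ _ (fun u => k + u) E); last exact: cE.
exact: is_derive_continuous_at (is_derive_add (is_derive_cst_fun k u) (is_derive_id_fun u)).
Qed.

(** By rotation invariance in one plane at a time, the Fourier kernel may be
    replaced by one that depends on a single coordinate; integrating out the
    others one by one then leaves iterated transforms abel. *)
Lemma real_integral_wave n A q (H1 E1 H2 E2 : R -> R) (xi : 'rV[R]_n.+1) :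
  profile A H1 -> profile A H2 -> continuous E1 -> continuous E2 ->
  real_integral (fun x => wave H1 E1 H2 E2 (q + dotp x x) (dotp xi x)) =
  \int[mu]_t wave (iter n abel H1) E1 (iter n abel H2) E2 (q + t ^+ 2) (enorm xi * t).
Proof.
move=> H1A H2A; elim: n q E1 E2 xi => [|n IHn] q E1 E2 xi cE1 cE2.
  have [c [eta ->]] := row_mx_split xi.
  rewrite /enorm [in RHS]dotp_row_mx.
  have d0 (x y : 'rV[R]_0) : dotp x y = 0 by rewrite /dotp big_ord0.
  rewrite d0 addr0 -expr2 sqrtr_sqr.
  rewrite -(wave_reflection H1A H2A cE1 cE2).
  by apply: eq_Rintegral => t _ /=; rewrite !dotp_row_mx !d0 !addr0 expr2.
have [c [eta ->]] := row_mx_split xi.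
rewrite /enorm [in RHS]dotp_row_mx -enorm_sqr -expr2.
transitivity (\int[mu]_t \int[mu]_s
   wave (iter n abel H1) E1 (iter n abel H2) E2 (q + t ^+ 2 + s ^+ 2) (c * t + enorm eta * s)).
  rewrite real_integralS; apply: eq_Rintegral => t _.
  rewrite -(IHn (q + t ^+ 2) _ _ eta (@continuous_translate (c * t) _ cE1) (@continuous_translate (c * t) _ cE2)).
  by congr real_integral; apply/funext => y; rewrite !dotp_row_mx -expr2 addrA.
rewrite (wave_rotation (profile_iter_abel n H1A) (profile_iter_abel n H2A) cE1 cE2).
apply: eq_Rintegral => t _.
by rewrite (wave_abel _ _ (profile_iter_abel n H1A) (profile_iter_abel n H2A)).
Qed.

End RadialIntegrals.

(** * Integrating a radial function over a plane *)

Section Polar.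
Context {R : realType}.
Local Notation mu := (@lebesgue_measure R).
Local Notation mR := (measurableTypeR R).
Implicit Types (q s t u v c d : R).
Variables (A q0 : R) (H G : R -> R).
Hypotheses (HA : profile A H) (cG : continuous G).
Hypothesis dG : forall q, q0 < q -> is_derive q 1 G (H q).
Hypothesis G0 : forall q, A <= q -> G q = 0.

Lemma integral_atan : \int[mu]_(v in `[-1, 1]) (1 + v ^+ 2)^-1 = pi / 2 :> R.
Proof.
rewrite (@integral_itv_primitive R _ _ _ (@atan R)).
- by rewrite atanN atan1; field.
- by rewrite -subr_gt0; lra.
- move=> x; apply: cvgV.
    by rewrite gt_eqF// ltr_pwDl// sqr_ge0.
  exact: continuous_sqr_shift.
- exact: is_derive_continuous (@is_derive1_atan R).
Qed.

(** The factor |s|, which is the Jacobian of t = s v, makes the integrand a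
    derivative in s on either side of 0. *)
Lemma ray_integral v :
  \int[mu]_s (`|s| * H (q0 + s ^+ 2 * (1 + v ^+ 2))) = - G q0 / (1 + v ^+ 2).
Proof.
set c := 1 + v ^+ 2; have c1 : 1 <= c by rewrite lerDl sqr_ge0.
have c0 : 0 < c by apply: lt_le_trans c1.
pose B := cutoff A q0.
have B0 : 0 < B by rewrite /B /cutoff -addrA ltr_pwDl// addr_ge0.
have ge s : ~~ (- B < s < B) -> A <= q0 + s ^+ 2 * c.
  by move=> /cutoffP sB; apply: (le_trans sB); rewrite lerD2l ler_peMr// sqr_ge0.
have dq s : is_derive s 1 (fun s => q0 + s ^+ 2 * c) (2 * s * c).
  have := is_derive_add (is_derive_cst_fun q0 s) (is_derive_scale c (is_derive_mul (is_derive_id_fun s) (is_derive_id_fun s))).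
  rewrite add0r (_ : c * _ = 2 * s * c); last by ring.
  by rewrite (_ : (fun y => _) = (fun s => q0 + s ^+ 2 * c))//; apply/funext => y; rewrite expr2 mulrC.
have cq : continuous (fun s => q0 + s ^+ 2 * c) by exact: is_derive_continuous dq.
have cf : continuous (fun s => H (q0 + s ^+ 2 * c)).
  by move=> s; apply: continuous_comp; [exact: cq|exact: HA.1].
have cGq (k : R) : continuous (fun s => k * G (q0 + s ^+ 2 * c)).
  move=> s; apply: cvgM; first exact: cvg_cst.
  by apply: (@continuous_comp _ _ _ (fun s => q0 + s ^+ 2 * c)); [exact: cq|exact: cG].
have cF : continuous (fun s => `|s| * H (q0 + s ^+ 2 * c)).
  by move=> s; apply: cvgM; [exact: norm_continuous|exact: cf].
rewrite (@integral_vanish_out _ (- B) B); last first.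
  by move=> s /ge sB; rewrite HA.2// mulr0.
have sgnE (e : R) s : s != 0 -> `|s| = e * s -> is_derive s 1 (fun s => (2 * c)^-1 * e * G (q0 + s ^+ 2 * c)) (`|s| * H (q0 + s ^+ 2 * c)).
  move=> s0 es.
  have -> : `|s| * H (q0 + s ^+ 2 * c) = (2 * c)^-1 * e * (H (q0 + s ^+ 2 * c) * (2 * s * c)).
    by rewrite es; field; rewrite gt_eqF.
  apply: is_derive_scale.
  have qs : q0 < q0 + s ^+ 2 * c by rewrite ltrDl mulr_gt0// exprn_even_gt0.
  exact: (@is_derive_comp R G (fun s => q0 + s ^+ 2 * c) s _ _ (dG qs) (dq s)).
have iF : mu.-integrable `[- B, B] (EFin \o (fun s => `|s| * H (q0 + s ^+ 2 * c))).
  exact: integrable_cont_itv.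
have NB0 : - B < 0 by rewrite oppr_lt0.
have E0 : G (q0 + 0 ^+ 2 * c) = G q0 by rewrite expr0n/= mul0r addr0.
have EB s : `|s| = B -> G (q0 + s ^+ 2 * c) = 0.
  move=> sB; apply/G0/ge/negP => sBB.
  have : `|s| < B by rewrite ltr_norml.
  by rewrite sB ltxx.
rewrite -(subrK (\int[mu]_(s in `[- B, 0]) (`|s| * H (q0 + s ^+ 2 * c))) (\int[mu]_(s in `[- B, B]) _)).
rewrite Rintegral_itvB// ?bnd_simp; [|exact: ltW|exact: ltW].
rewrite Rintegral_itv_obnd_cbnd; last first.
  by apply: integrableS iF => //; apply: subset_itvr; rewrite bnd_simp ltW.
have dr s : 0 < s < B -> is_derive s 1 (fun s => (2 * c)^-1 * 1 * G (q0 + s ^+ 2 * c)) (`|s| * H (q0 + s ^+ 2 * c)).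
  by move=> /andP[s0 _]; apply: sgnE; rewrite ?gt_eqF// mul1r gtr0_norm.
have dl s : - B < s < 0 -> is_derive s 1 (fun s => (2 * c)^-1 * -1 * G (q0 + s ^+ 2 * c)) (`|s| * H (q0 + s ^+ 2 * c)).
  by move=> /andP[_ s0]; apply: sgnE; rewrite ?lt_eqF// mulN1r ltr0_norm.
rewrite (integral_itv_primitive B0 cF dr (cGq _)).
rewrite (integral_itv_primitive NB0 cF dl (cGq _)).
rewrite E0 !EB ?normrN ?gtr0_norm//.
by field; rewrite gt_eqF.
Qed.

Let F (z : mR * mR) : R := if `|z.2| <= `|z.1| then H (q0 + z.1 ^+ 2 + z.2 ^+ 2) else 0.
Let F' (z : mR * mR) : R := if `|z.1| < `|z.2| then H (q0 + z.1 ^+ 2 + z.2 ^+ 2) else 0.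

Let sector_facts (e : mR * mR -> bool) (F'' := fun z : mR * mR =>
    if e z then H (q0 + z.1 ^+ 2 + z.2 ^+ 2) else 0) :
  measurable_fun setT e ->
  exists M, [/\ measurable_fun setT F'', (forall z, `|F'' z| <= M) &
    forall z, ~~ ((- cutoff A q0 < z.1 < cutoff A q0) &&
                  (- cutoff A q0 < z.2 < cutoff A q0)) -> F'' z = 0].
Proof.
move=> me; have [M M0 HM] := profile_bounded q0 HA; exists M; split.
- apply: measurable_fun_ifT => //.
  apply: (measurableT_comp (continuous_measurable_fun HA.1)).
  apply: measurable_funD; last by apply: measurable_funX; exact: measurable_snd.
  by apply: measurable_funD => //; apply: measurable_funX; exact: measurable_fst.
- move=> z; rewrite /F''; case: ifP => _; last by rewrite normr0.
  by apply: HM; rewrite -addrA lerDl addr_ge0// sqr_ge0.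
- move=> z; rewrite negb_and /F'' => /orP[] /cutoffP zA; case: ifP => // _; apply: HA.2.
    by apply: (le_trans zA); rewrite lerDl sqr_ge0.
  by apply: (le_trans zA); rewrite addrAC lerDl sqr_ge0.
Qed.

Let mabs1 : measurable_fun setT (fun z : mR * mR => `|z.1|).
Proof. by apply: measurableT_comp => //; exact: measurable_fst. Qed.

Let mabs2 : measurable_fun setT (fun z : mR * mR => `|z.2|).
Proof. by apply: measurableT_comp => //; exact: measurable_snd. Qed.

Let mF := sector_facts (measurable_fun_ler mabs2 mabs1).
Let mF' := sector_facts (measurable_fun_ltr mabs1 mabs2).

Let F_itv s : \int[mu]_t F (s, t) = \int[mu]_(t in `[- `|s|, `|s|]) H (q0 + s ^+ 2 + t ^+ 2).
Proof.
rewrite [RHS]Rintegral_mkcond; apply: eq_Rintegral => t _.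
by rewrite patchE /F/= mem_setE/= in_itv/= ler_norml.
Qed.

Let swap_sector s : \int[mu]_t F' (t, s) = \int[mu]_t F (s, t).
Proof.
rewrite F_itv.
have cf : continuous (fun t => H (q0 + s ^+ 2 + t ^+ 2)).
  exact: profile_section_continuous HA.
rewrite -Rintegral_itv_obnd_cbnd; last first.
  apply: integrableS (integrable_cont_itv (- `|s|) `|s| cf) => //.
  by apply: subset_itvr; rewrite bnd_simp.
rewrite -Rintegral_itv_bndo_bndc; last first.
  apply: integrableS (integrable_cont_itv (- `|s|) `|s| cf) => //.
  exact: subset_itv_oo_cc.
rewrite [RHS]Rintegral_mkcond; apply: eq_Rintegral => t _.
by rewrite patchE /F'/= mem_setE/= in_itv/= ltr_norml addrAC.
Qed.

(** The substitution t = |s| v in the inner integral over the sector. *)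
Let sector_slope s : \int[mu]_t F (s, t) =
  \int[mu]_(v in `[-1, 1]) (`|s| * H (q0 + s ^+ 2 * (1 + v ^+ 2))).
Proof.
rewrite F_itv.
have cf : continuous (fun t => H (q0 + s ^+ 2 + t ^+ 2)).
  exact: profile_section_continuous HA.
have [P dP] := exists_primitive cf (profile_section_vanish HA (lexx _)).
have sq v : q0 + s ^+ 2 + (`|s| * v + 0) ^+ 2 = q0 + s ^+ 2 * (1 + v ^+ 2).
  by rewrite addr0 exprMn real_normK ?num_real//; ring.
have dQ v : is_derive v 1 (fun v => P (`|s| * v + 0)) (`|s| * H (q0 + s ^+ 2 * (1 + v ^+ 2))).
  by rewrite -sq; apply: is_derive_comp_affine.
have cg : continuous (fun v => `|s| * H (q0 + s ^+ 2 * (1 + v ^+ 2))).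
  move=> v; apply: cvgM; first exact: cvg_cst.
  under eq_cvg do rewrite -sq; rewrite -sq.
  apply: (@continuous_comp _ _ _ (fun v => `|s| * v + 0) (fun t => H (q0 + s ^+ 2 + t ^+ 2))); last exact: cf.
  exact: is_derive_continuous_at (is_derive_affine `|s| 0 v).
have N11 : (-1 : R) < 1 by rewrite -subr_gt0; lra.
rewrite (integral_itv_primitive N11 cg (fun v _ => dQ v) (is_derive_continuous dQ)).
rewrite !addr0 mulr1 mulrN1.
have [->|sN0] := eqVneq s 0.
  by rewrite normr0 oppr0 set_itv1 Rintegral_set1 subrr.
have sN : - `|s| < `|s| by rewrite gt0_cp// normr_gt0.
by rewrite (integral_itv_primitive sN cf (fun v _ => dP v) (is_derive_continuous dP)).
Qed.

(** Polar coordinates: by symmetry the plane may be replaced by twice the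
    sector |t| <= |s|, where t = s v separates the variables. *)
Lemma abel_abel : abel (abel H) q0 = - pi * G q0.
Proof.
have [M [mF1 FM F0]] := mF; have [M' [mF'1 FM' F'0]] := mF'.
have -> : abel (abel H) q0 = \int[mu]_s (\int[mu]_t F (s, t) + \int[mu]_t F' (s, t)).
  apply: eq_Rintegral => s _; rewrite -RintegralD//.
  - apply: eq_Rintegral => t _; rewrite /F /F'/=.
    by case: leP; rewrite ?addr0 ?add0r.
  - exact: integrable_vertical mF1 FM F0 s.
  - exact: integrable_vertical mF'1 FM' F'0 s.
rewrite RintegralD//; last 2 first.
- exact: integrable_vertical_integral mF1 FM F0.
- exact: integrable_vertical_integral mF'1 FM' F'0.
have -> : \int[mu]_s \int[mu]_t F' (s, t) = \int[mu]_s \int[mu]_t F (s, t).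
  rewrite (Fubini_vanish_out mF'1 FM' F'0).
  by apply: eq_Rintegral => s _; exact: swap_sector.
pose K (z : mR * mR) : R := 
  if `|z.2| <= 1 then `|z.1| * H (q0 + z.1 ^+ 2 * (1 + z.2 ^+ 2)) else 0.
have -> : \int[mu]_s \int[mu]_t F (s, t) = \int[mu]_s \int[mu]_v K (s, v).
  apply: eq_Rintegral => s _; rewrite sector_slope Rintegral_mkcond.
  by apply: eq_Rintegral => v _; rewrite patchE mem_setE/= in_itv/= /K ler_norml.
have [N N0 HN] := profile_bounded q0 HA.
pose B := cutoff A q0.
have B1 : 1 <= B by rewrite /B /cutoff -addrA lerDl addr_ge0.
have KB z : ~~ (- B < z.1 < B) -> K z = 0.
  move=> /cutoffP zA; rewrite /K; case: ifP => // _; rewrite HA.2 ?mulr0//.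
  by apply: (le_trans zA); rewrite lerD2l ler_peMr ?sqr_ge0// lerDl sqr_ge0.
rewrite (@Fubini_vanish_out R (- (B + 1)) (B + 1) (B * N) K); last 3 first.
- apply: measurable_fun_ifT => //.
    exact: measurable_fun_ler mabs2 _.
  apply: measurable_funM => //.
  apply: (measurableT_comp (continuous_measurable_fun HA.1)).
  apply: measurable_funD => //; apply: measurable_funM.
    by apply: measurable_funX; exact: measurable_fst.
  by apply: measurable_funD => //; apply: measurable_funX; exact: measurable_snd.
- move=> z; have [zB|/KB ->] := boolP (- B < z.1 < B); last first.
    by rewrite normr0 mulr_ge0// (le_trans _ B1).
  rewrite /K; case: ifP => _; last by rewrite normr0 mulr_ge0// (le_trans _ B1).
  rewrite normrM normr_id; apply: ler_pM => //; first by rewrite ler_norml !ltW//; case/andP: zB.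
  by apply: HN; rewrite lerDl mulr_ge0// ?sqr_ge0// addr_ge0// sqr_ge0.
- move=> z; rewrite negb_and => /orP[z1|z2].
    apply: KB; apply: contra z1 => /andP[Bz zB].
    by rewrite (lt_trans _ Bz) ?(lt_trans zB)// ?ltrN2 ltrDl.
  rewrite /K; case: ifP => // z21; case/negP: z2; rewrite -ltr_norml.
  by rewrite (le_lt_trans z21)// ltrDr (lt_le_trans _ B1).
have -> : \int[mu]_v \int[mu]_s K (s, v) = \int[mu]_(v in `[-1, 1]) (- G q0 * (1 + v ^+ 2)^-1).
  rewrite [RHS]Rintegral_mkcond; apply: eq_Rintegral => v _.
  rewrite patchE mem_setE/= in_itv/= -ler_norml /K/=; case: ifP => _.
    exact: ray_integral.
  by rewrite Rintegral_cst// mul0r.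
rewrite RintegralZl//; last first.
  apply: integrable_cont_itv => v; apply: cvgV; last exact: continuous_sqr_shift.
  by rewrite gt_eqF// ltr_pwDl// sqr_ge0.
by rewrite integral_atan; field.
Qed.

End Polar.

(** * Smooth functions of one variable and division by the variable *)

Section ParameterIntegrals.
Context {R : realType}.
Local Notation mu := (@lebesgue_measure R).

Implicit Types y t : R.

Lemma is_derive_integral (a b u v M : R) (f f' : R -> R -> R) (x : R) :
  u < x < v ->
  (forall y t, is_derive y 1 (fun y => f y t) (f' y t)) ->
  (forall y, continuous (f y)) ->
  (forall y t, u < y < v -> a <= t <= b -> `|f' y t| <= M) ->
  is_derive x 1 (fun y => \int[mu]_(t in `[a, b]) f y t)
                (\int[mu]_(t in `[a, b]) f' x t).
Proof.
move=> uxv df cf f'M.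
have d1 y t : ((fun z => f z t)^`())%classic y = f' y t.
  by rewrite derive1E; have [_ ->] := df y t.
have d1' y t : partial1of2 f y t = f' y t by exact: d1.
pose M' := `|M|.
have mI : measurable (`[a, b]%classic : set (measurableTypeR R)).
  exact: measurable_itv.
have Ix : `]u, v[%classic x by rewrite /= in_itv.
have int_f y : `]u, v[%classic y -> mu.-integrable `[a, b] (EFin \o f y).
  by move=> _; exact: integrable_cont_itv.
have df1 y t : `]u, v[%classic y -> `[a, b]%classic t -> derivable (f^~ t) y 1.
  by move=> _ _; have [] := df y t.
have M'0 (y : measurableTypeR R) : 0 <= cst M' y by rewrite /= /M'.
have iM : mu.-integrable `[a, b] (EFin \o cst M').
  by apply: integrable_cont_itv; exact: cst_continuous.
have ub y t : `]u, v[%classic y -> `[a, b]%classic t -> `|partial1of2 f y t| <= cst M' t.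
  rewrite /= !in_itv/= d1' => uyv atb.
  by apply: le_trans (f'M _ _ uyv atb) _; exact: ler_norm.
apply: DeriveDef.
  exact: (@derivable_under_integral R _ _ mu f _ mI x u v Ix int_f df1 _ M'0 iM ub).
rewrite -derive1E.
rewrite (@differentiation_under_integral R _ _ mu f _ mI x u v Ix int_f df1 _ M'0 iM ub).
by apply: eq_Rintegral => t _; rewrite d1'.
Qed.

End ParameterIntegrals.

Section Jets.
Context {R : realType}.
Local Notation mu := (@lebesgue_measure R).
Implicit Types (f g : nat -> R -> R) (a b r s t x : R) (n m : nat).

(** A smooth function is handled as the sequence of its derivatives. *)
Definition jet f := forall n x, is_derive x 1 (f n) (f n.+1 x).

Lemma jet_continuous f : jet f -> forall n, continuous (f n).
Proof. by move=> jf n; exact: is_derive_continuous (jf n). Qed.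
Arguments jet_continuous [f] _ n.

Definition jet_shift f : nat -> R -> R := fun n => f n.+1.

Lemma jet_shiftP f : jet f -> jet (jet_shift f).
Proof. by move=> jf n; exact: jf. Qed.

Definition jet_scale a f : nat -> R -> R := fun n x => a * f n x.

Lemma jet_scaleP a f : jet f -> jet (jet_scale a f).
Proof. by move=> jf n x; apply: is_derive_scale. Qed.

(** Twice the odd part. *)
Definition jet_odd f : nat -> R -> R := fun n x => f n x - (-1) ^+ n * f n (- x).

Lemma jet_oddP f : jet f -> jet (jet_odd f).
Proof.
move=> jf n x; apply: is_derive_add => //.
rewrite exprS mulN1r mulNr opprK -[X in is_derive _ _ _ X]opprK; apply: is_derive_opp.
rewrite -mulrN; apply: is_derive_scale.
have := @is_derive_comp_affine R (f n) x (-1) 0 (f n.+1 (- x)).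
rewrite addr0 mulN1r => /(_ (jf n _)).
by rewrite mulN1r; congr (is_derive _ _ _ _); apply/funext => y; rewrite mulN1r addr0.
Qed.

(** The quotient (g(r) - g(0)) / r, written as the integral of g'(t r) over
    [0, 1] so as to be visibly smooth at r = 0. *)
Definition jet_quot g : nat -> R -> R :=
  fun n r => \int[mu]_(t in `[0, 1]) (t ^+ n * g n.+1 (t * r)).

Let is_derive_mulr g n t x : jet g ->
  is_derive x 1 (fun r => t ^+ n * g n.+1 (t * r)) (t ^+ n.+1 * g n.+2 (t * x)).
Proof.
move=> jg; rewrite exprSr -mulrA; apply: is_derive_scale.
have := @is_derive_comp_affine R (g n.+1) x t 0 (g n.+2 (t * x)).
rewrite addr0 => /(_ (jg _ _)).
by congr (is_derive _ _ _ _); apply/funext => y; rewrite addr0.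
Qed.

Let continuous_mulr g n r : jet g -> continuous (fun t => t ^+ n * g n.+1 (t * r)).
Proof.
move=> jg t; apply: cvgM; first exact: exprn_continuous.
apply: (@continuous_comp _ _ _ (fun t => t * r) (g n.+1)).
  by apply: cvgM; [exact: cvg_id|exact: cvg_cst].
exact: jet_continuous.
Qed.

Lemma jet_quot_bound g n r (M : R) : jet g ->
  (forall s, `|s| <= `|r| -> `|g n.+1 s| <= M) -> `|jet_quot g n r| <= M.
Proof.
move=> jg gM.
have mI : measurable (`[0, 1]%classic : set (measurableTypeR R)).
  exact: measurable_itv.
have cm := @continuous_mulr g n r jg.
apply: le_trans (le_normr_Rintegral mI (integrable_cont_itv 0 1 cm)) _.
have -> : M = \int[mu]_(t in `[0, 1]) (cst M t).
  rewrite Rintegral_cst//= lebesgue_measure_itv/= lte_fin ltr01 -EFinB/=.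
  by rewrite subr0 mulr1.
have cn : continuous (fun t => `|t ^+ n * g n.+1 (t * r)|).
  by move=> t; apply: cvg_norm; exact: cm.
have cM : continuous (fun _ : R => M) by exact: cst_continuous.
apply: le_Rintegral => //.
- exact: integrable_cont_itv cn.
- exact: integrable_cont_itv cM.
- move=> t; rewrite /= in_itv/= => /andP[t0 t1].
  rewrite normrM -[leRHS]mul1r; apply: ler_pM => //.
    by rewrite normrX exprn_ile1// ger0_norm.
  by apply: gM; rewrite normrM ger0_norm// ler_piMl.
Qed.

Lemma jet_quotP g : jet g -> jet (jet_quot g).
Proof.
move=> jg n x.
have [M M0 gM] := bounded_on_segment (- (`|x| + 1)) (`|x| + 1) (jet_continuous jg n.+2).
apply: (@is_derive_integral R 0 1 (x - 1) (x + 1) M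
  (fun r t => t ^+ n * g n.+1 (t * r)) (fun r t => t ^+ n.+1 * g n.+2 (t * r))).
- by rewrite ltrBlDr !ltrDl ltr01.
- by move=> y t; exact: is_derive_mulr.
- by move=> y; exact: continuous_mulr.
- move=> y t /andP[xy yx] /andP[t0 t1].
  have yx1 : `|y| <= `|x| + 1.
    rewrite -lerBlDl; apply: le_trans (lerB_dist _ _) _.
    by rewrite ler_norml; apply/andP; split; lra.
  rewrite normrM -[leRHS]mul1r; apply: ler_pM => //.
    by rewrite normrX exprn_ile1// ger0_norm.
  by apply: gM; rewrite -ler_norml normrM [`|t|]ger0_norm// (le_trans _ yx1)// ler_piMl.
Qed.

Lemma jet_quotE g r : jet g -> r * jet_quot g 0 r = g 0 r - g 0 0.
Proof.
move=> jg.
have cm := @continuous_mulr g 0 r jg.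
rewrite /jet_quot -RintegralZl//; last exact: integrable_cont_itv.
have dF x : is_derive x 1 (fun t => g 0 (r * t + 0)) (r * (x ^+ 0 * g 1 (x * r))).
  rewrite mul1r [x * r]mulrC -[r * x]addr0; apply: is_derive_comp_affine.
  exact: jg.
have cF : continuous (fun t => r * (t ^+ 0 * g 1 (t * r))).
  by move=> t; apply: cvgM; [exact: cvg_cst|exact: cm].
rewrite (integral_itv_primitive ltr01 cF (fun x _ => dF x) (is_derive_continuous dF)).
by rewrite mulr1 mulr0 !addr0.
Qed.

(** The Leibniz formula for the (n+1)st derivative of r (g(r) - g(0)) / r. *)
Lemma jet_quotSE g n r : jet g ->
  r * jet_quot g n.+1 r + n.+1%:R * jet_quot g n r = g n.+1 r.
Proof.
move=> jg; have jq := jet_quotP jg.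
elim: n r => [|n IHn] r.
  have d1 : is_derive r 1 (fun r => r * jet_quot g 0 r) (r * jet_quot g 1 r + 1 * jet_quot g 0 r).
    by rewrite [1 * _]mulrC; apply: is_derive_mul => //; exact: is_derive_id_fun.
  apply: (is_derive_unique d1).
  rewrite (_ : (fun r => _) = (fun r => g 0 r + - g 0 0)); last by apply/funext => s; rewrite jet_quotE.
  by rewrite -[g 1 r]addr0; apply: is_derive_add => //; exact: is_derive_cst_fun.
have d1 : is_derive r 1 (fun r => r * jet_quot g n.+1 r + n.+1%:R * jet_quot g n r)
   (r * jet_quot g n.+2 r + jet_quot g n.+1 r * 1 + n.+1%:R * jet_quot g n.+1 r).
  apply: is_derive_add; last exact: is_derive_scale.
  by apply: is_derive_mul => //; exact: is_derive_id_fun.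
rewrite [n.+2%:R](natrD _ 1) mulrDl mul1r addrA -[X in _ + X + _]mulr1.
apply: (is_derive_unique d1).
by rewrite (_ : (fun r => _) = g n.+1)//; apply/funext.
Qed.

Lemma jet_quot0 g n : jet g -> jet_quot g n 0 = g n.+1 0 / n.+1%:R.
Proof.
move=> jg; by rewrite -(jet_quotSE n 0 jg) mul0r add0r mulrC mulKf.
Qed.

(** The operator f |-> f'(r) / r on even functions. *)
Definition jet_radial f := jet_quot (jet_shift f).

Lemma jet_radialP f : jet f -> jet (jet_radial f).
Proof. by move=> jf; apply/jet_quotP/jet_shiftP. Qed.

Definition even_jet f := forall x, f 0 (- x) = f 0 x.

Lemma even_jet_d0 f : jet f -> even_jet f -> f 1 0 = 0.
Proof.
move=> jf ef.
have d : is_derive (0 : R) 1 (fun x => f 0 (-1 * x + 0)) (-1 * f 1 0).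
  by apply: is_derive_comp_affine; rewrite mulr0 addr0; exact: jf.
have : -1 * f 1 0 = f 1 0.
  apply: (is_derive_unique d).
  by rewrite (_ : (fun x => _) = f 0)//; apply/funext => x; rewrite mulN1r addr0 ef.
by move=> h; apply/eqP; rewrite -[_ == 0](mulrn_eq0 _ 2) mulr2n -{1}h mulN1r addNr.
Qed.

Lemma jet_radialE f r : jet f -> even_jet f -> r * jet_radial f 0 r = f 1 r.
Proof.
move=> jf ef; rewrite jet_quotE; last exact: jet_shiftP.
by rewrite /jet_shift even_jet_d0// subr0.
Qed.

Lemma even_jet_d1 f x : jet f -> even_jet f -> f 1 (- x) = - f 1 x.
Proof.
move=> jf ef.
have d : is_derive x 1 (fun x => f 0 (-1 * x + 0)) (-1 * f 1 (- x)).
  by apply: is_derive_comp_affine; rewrite mulN1r addr0; exact: jf.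
have : -1 * f 1 (- x) = f 1 x.
  apply: (is_derive_unique d).
  by rewrite (_ : (fun x => _) = f 0)//; apply/funext => y; rewrite mulN1r addr0 ef.
by move=> <-; rewrite mulN1r opprK.
Qed.

Lemma even_jet_radial f : jet f -> even_jet f -> even_jet (jet_radial f).
Proof.
move=> jf ef r; have [->|r0] := eqVneq r 0; first by rewrite oppr0.
apply: (mulfI r0); rewrite jet_radialE//.
by rewrite -[r]opprK mulNr opprK jet_radialE// even_jet_d1// opprK.
Qed.

Lemma even_jet_quot_odd f : jet f -> even_jet (jet_quot (jet_odd f)).
Proof.
move=> jf r; have [->|r0] := eqVneq r 0; first by rewrite oppr0.
have jo := jet_oddP jf.
apply: (mulfI r0); apply: oppr_inj; rewrite -mulNr !jet_quotE//.
by rewrite /jet_odd !expr0 !mul1r opprK oppr0; ring.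
Qed.

End Jets.

Arguments jet_continuous {R f} _ n.

(** * Weighted bounds on derivatives *)

Section JetBounds.
Context {R : realType}.
Implicit Types (f g : nat -> R -> R) (a b r s t x c : R) (n m N : nat).

Definition jet_bound N n f c :=
  forall j x, (j <= n)%N -> (1 + `|x|) ^+ N * `|f j x| <= c.

Lemma weight_ge1 N x : 1 <= (1 + `|x|) ^+ N.
Proof. by rewrite exprn_ege1// lerDl. Qed.

Lemma jet_bound_ge0 N n f c : jet_bound N n f c -> 0 <= c.
Proof.
move=> /(_ 0%N 0 (leq0n _)); apply: le_trans.
by rewrite mulr_ge0// exprn_ge0// addr_ge0.
Qed.

Lemma jet_bound_sup N n f c j x : jet_bound N n f c -> (j <= n)%N -> `|f j x| <= c.
Proof.
move=> fc jn; apply: le_trans (fc _ x jn).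
by rewrite ler_peMl// weight_ge1.
Qed.

Lemma jet_bound_leq N n N' n' f c : (N' <= N)%N -> (n' <= n)%N ->
  jet_bound N n f c -> jet_bound N' n' f c.
Proof.
move=> NN nn fc j x jn; apply: le_trans (fc j x (leq_trans jn nn)).
by rewrite ler_wpM2r// ler_weXn2l// lerDl.
Qed.

Lemma jet_bound_scale N n f c a : jet_bound N n f c ->
  jet_bound N n (jet_scale a f) (`|a| * c).
Proof.
by move=> fc j x jn; rewrite /jet_scale normrM mulrCA ler_wpM2l// fc.
Qed.

Lemma jet_bound_odd N n f c : jet_bound N n f c -> jet_bound N n (jet_odd f) (2 * c).
Proof.
move=> fc j x jn; rewrite /jet_odd mulr_natl mulr2n.
apply: le_trans (_ : (1 + `|x|) ^+ N * (`|f j x| + `|f j (- x)|) <= _).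
  rewrite ler_wpM2l ?exprn_ge0 ?addr_ge0//.
  by apply: le_trans (ler_normB _ _) _; rewrite normrM normrX normrN1 expr1n mul1r.
by rewrite mulrDr lerD ?fc//; have := fc j (- x) jn; rewrite normrN.
Qed.

(** Near 0 the quotient is controlled by the derivative of g, and for |r| >= 1
    by g itself. *)
Lemma jet_bound_quot N n : exists2 C : R, 0 <= C & forall g c, jet g -> g 0%N 0 = 0 ->
  jet_bound N n.+1 g c -> jet_bound N n (jet_quot g) (C * c).
Proof.
have near0 g c j r : jet g -> jet_bound N j.+1 g c -> `|r| <= 1 ->
    (1 + `|r|) ^+ N * `|jet_quot g j r| <= 2 ^+ N * c.
  move=> jg gc r1; apply: ler_pM => //.
  - by rewrite lerXn2r// ?nnegrE ?addr_ge0//; lra.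
  - by apply: jet_quot_bound => // s _; apply: jet_bound_sup gc _.
have far g r j : 1 <= `|r| -> (1 + `|r|) ^+ N * `|jet_quot g j r| <=
    (1 + `|r|) ^+ N * `|r * jet_quot g j r|.
  move=> r1; rewrite ler_wpM2l ?exprn_ge0 ?addr_ge0//.
  by rewrite normrM ler_peMl.
elim: n => [|n [C C0 IHn]].
  exists (2 ^+ N + 1) => [|g c jg g0 gc j r]; first by rewrite addr_ge0// exprn_ge0.
  rewrite leqn0 => /eqP ->; have c0 := jet_bound_ge0 gc.
  rewrite mulrDl mul1r; have [r1|/ltW r1] := leP `|r| 1.
    by apply: le_trans (near0 _ _ _ _ jg gc r1) _; rewrite lerDl.
  apply: le_trans (far _ _ _ r1) _; rewrite jet_quotE// g0 subr0.
  by apply: le_trans (gc _ _ (leq0n _)) _; rewrite lerDr mulr_ge0// exprn_ge0.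
exists (C + (2 ^+ N + (1 + n.+1%:R * C))) => [|g c jg g0 gc j r].
  by rewrite !addr_ge0// ?exprn_ge0// mulr_ge0.
have c0 := jet_bound_ge0 gc.
have K0 : 0 <= 2 ^+ N * c by rewrite mulr_ge0// exprn_ge0.
have K1 : 0 <= C * c by rewrite mulr_ge0.
have K2 : 0 <= n.+1%:R * (C * c) by rewrite mulr_ge0.
have gc' : jet_bound N n.+1 g c by apply: jet_bound_leq gc.
rewrite leq_eqVlt => /predU1P[->|]; last first.
  rewrite ltnS => jn; apply: le_trans (IHn g c jg g0 gc' j r jn) _.
  by rewrite ler_wpM2r// lerDl !addr_ge0// ?exprn_ge0// mulr_ge0.
have -> : (C + (2 ^+ N + (1 + n.+1%:R * C))) * c =
   C * c + 2 ^+ N * c + c + n.+1%:R * (C * c) by ring.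
have [r1|/ltW r1] := leP `|r| 1.
  by apply: le_trans (near0 _ _ _ _ jg gc r1) _; lra.
apply: le_trans (far _ _ _ r1) _.
have -> : r * jet_quot g n.+1 r = g n.+1 r - n.+1%:R * jet_quot g n r.
  by rewrite -(jet_quotSE n r jg) addrK.
apply: le_trans (_ : (1 + `|r|) ^+ N * (`|g n.+1 r| + n.+1%:R * `|jet_quot g n r|) <= _).
  rewrite ler_wpM2l ?exprn_ge0 ?addr_ge0//.
  by apply: le_trans (ler_normB _ _) _; rewrite normrM normr_nat.
rewrite mulrDr mulrCA; have h1 := gc n.+1 r (leqnSn _).
have h2 : n.+1%:R * ((1 + `|r|) ^+ N * `|jet_quot g n r|) <= n.+1%:R * (C * c).
  by rewrite ler_wpM2l// IHn.
by lra.
Qed.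

(** One order is lost to the derivative and another one to the quotient. *)
Lemma jet_bound_radial N n : exists2 C : R, 0 <= C & forall f c, jet f -> even_jet f ->
  jet_bound N n.+2 f c -> jet_bound N n (jet_radial f) (C * c).
Proof.
have [C C0 HC] := jet_bound_quot N n; exists C => // f c jf ef fc.
apply: HC; [exact: jet_shiftP|exact: even_jet_d0|].
by move=> j x jn; apply: fc.
Qed.

Lemma jet_iter_radialP p f : jet f -> jet (iter p jet_radial f).
Proof. by move=> jf; elim: p => //= p; exact: jet_radialP. Qed.

Lemma even_jet_iter_radial p f : jet f -> even_jet f -> even_jet (iter p jet_radial f).
Proof.
by move=> jf ef; elim: p => //= p; apply: even_jet_radial; exact: jet_iter_radialP.
Qed.

Lemma jet_bound_iter_radial p N n : exists2 C : R, 0 <= C & forall f c, jet f -> even_jet f ->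
  jet_bound N (p.*2 + n) f c -> jet_bound N n (iter p jet_radial f) (C * c).
Proof.
elim: p n => [|p IHp] n; first by exists 1 => // f c _ _; rewrite mul1r.
have [C C0 HC] := IHp n.+2; have [D D0 HD] := jet_bound_radial N n.
exists (D * C) => [|f c jf ef fc]; first exact: mulr_ge0.
rewrite -mulrA; apply: HD; [exact: jet_iter_radialP|exact: even_jet_iter_radial|].
by apply: HC => //; rewrite doubleS 2!addSn in fc; rewrite 2!addnS.
Qed.

End JetBounds.

(** * Smooth radial functions *)

Section RadialFunctions.
Context {R : realType} {k : nat}.
Implicit Types (f g : nat -> R -> R) (F G : 'rV[R]_k -> R) (x : 'rV[R]_k) (i j : 'I_k).
Local Notation e_ i := (delta_mx (0 : 'I_1) (i : 'I_k) : 'rV[R]_k).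

Lemma is_derive_line F x v (l : R) :
  is_derive (0 : R) 1 (fun h => F (h *: v + x)) l -> is_derive x v F l.
Proof.
move=> [d dl].
have E : (fun h => h^-1 *: (((fun h => F (h *: v + x)) \o shift 0) (h *: 1) - F (0 *: v + x))) =
         (fun h : R => h^-1 *: ((F \o shift x) (h *: v) - F x)).
  by apply/funext => h; rewrite /= scale0r add0r /GRing.scale/= mulr1 addr0.
by split; [move: d; rewrite /derivable E|move: dl; rewrite /derive E].
Qed.

Lemma continuous_dotp : continuous (fun x : 'rV[R]_k => dotp x x).
Proof.
rewrite /dotp => x; apply: (@cvg_big _ _ +%R) => [||i _].
- exact: add_continuous.
- exact: nbhs_filter.
have c := @coord_continuous R _ _ 0 i x.
exact: (cvgM c c).
Qed.

Lemma continuous_enorm : continuous (@enorm R k).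
Proof.
move=> x; apply: (@continuous_comp _ _ _ (fun x : 'rV[R]_k => dotp x x) Num.sqrt).
  exact: continuous_dotp.
exact: sqrt_continuous.
Qed.

Lemma dotp_line x i (h : R) :
  dotp (h *: e_ i + x) (h *: e_ i + x) = dotp x x - x 0 i ^+ 2 + (h + x 0 i) ^+ 2.
Proof.
rewrite /dotp (bigD1 i)//= [in RHS](bigD1 i)//= !mxE !eqxx/= mulr1 -!expr2.
rewrite [RHS]addrC; congr (_ + _); rewrite addrAC subrr add0r.
apply: eq_bigr => j ji.
by rewrite !mxE (negbTE ji) andbF mulr0 add0r.
Qed.

Lemma coord_sqr_le_dotp x i : x 0 i ^+ 2 <= dotp x x.
Proof.
rewrite /dotp (bigD1 i)//= -expr2 lerDl; apply: sumr_ge0 => j _.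
by rewrite -expr2 sqr_ge0.
Qed.

Lemma coord_le_enorm x i : `|x 0 i| <= enorm x.
Proof.
by rewrite -(sqrtr_sqr (x 0 i)) ler_sqrt ?dotp_ge0// coord_sqr_le_dotp.
Qed.

Lemma enorm_ge0 x : 0 <= enorm x.
Proof. exact: sqrtr_ge0. Qed.

Lemma enorm0 : enorm (0 : 'rV[R]_k) = 0.
Proof. by rewrite /enorm /dotp big1 ?sqrtr0// => i _; rewrite mxE mul0r. Qed.

Lemma enorm_eq0 x : (enorm x == 0) = (x == 0).
Proof.
apply/eqP/eqP => [x0|->]; last exact: enorm0.
by apply/rowP => i; apply/eqP; rewrite mxE -normr_le0 -x0 coord_le_enorm.
Qed.

Definition radial f x := f 0%N (enorm x).

Lemma continuous_radial f : jet f -> continuous (radial f).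
Proof.
move=> jf x; apply: (@continuous_comp _ _ _ (@enorm R k) (f 0%N)).
  exact: continuous_enorm.
exact: jet_continuous jf _ _.
Qed.

(** Evenness makes the formula hold at the origin as well, where the norm is
    not differentiable. *)
Lemma is_derive_radial f x i : jet f -> even_jet f ->
  is_derive x (e_ i) (radial f) (x 0 i * radial (jet_radial f) x).
Proof.
move=> jf ef; apply: is_derive_line.
set a := x 0 i; pose S := dotp x x - a ^+ 2.
have S0 : 0 <= S by rewrite subr_ge0 coord_sqr_le_dotp.
have E h : radial f (h *: e_ i + x) = f 0%N (Num.sqrt (S + (1 * h + a) ^+ 2)).
  by rewrite /radial /enorm dotp_line mul1r.
have Ex : enorm x = Num.sqrt (S + a ^+ 2) by rewrite /enorm subrK.
rewrite (_ : (fun h => _) = (fun h => f 0%N (Num.sqrt (S + (1 * h + a) ^+ 2)))); last first.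
  by apply/funext => h; exact: E.
pose r := enorm x.
have [Sa0|Sa0] := eqVneq (S + a ^+ 2) 0.
  have [S00 a0] : S = 0 /\ a = 0.
    move/eqP: Sa0; rewrite paddr_eq0 ?sqr_ge0// sqrf_eq0 => /andP[/eqP -> /eqP ->].
    by [].
  rewrite a0 mul0r S00 (_ : (fun h => _) = f 0%N); last first.
    apply/funext => h; rewrite add0r mul1r addr0 sqrtr_sqr.
    by have [h0|h0] := leP 0 h; [rewrite ger0_norm|rewrite ltr0_norm// ef].
  by have := jf 0%N 0; rewrite (even_jet_d0 jf ef).
have Sa : 0 < S + a ^+ 2 by rewrite lt_neqAle eq_sym Sa0/= addr_ge0// sqr_ge0.
have d1 : is_derive (0 : R) 1 (fun h : R => (1 * h + a) * (1 * h + a)) (a * 1 + a * 1).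
  have := is_derive_mul (is_derive_affine 1 a 0) (is_derive_affine 1 a 0).
  by rewrite mulr0 add0r.
have d2 : is_derive (0 : R) 1 (fun h : R => S + (1 * h + a) ^+ 2) (2 * a).
  by have := is_derive_add (is_derive_cst_fun S 0) d1; rewrite add0r mulr1 -mulr2n mulr_natl.
have d3 : is_derive (0 : R) 1 (fun h : R => Num.sqrt (S + (1 * h + a) ^+ 2)) ((2 * r)^-1 * (2 * a)).
  apply: (@is_derive_comp _ Num.sqrt (fun h => S + (1 * h + a) ^+ 2)) => //.
  by rewrite mulr0 add0r /r Ex; exact: (is_derive1_sqrt Sa).
have d4 : is_derive (0 : R) 1 (fun h : R => f 0%N (Num.sqrt (S + (1 * h + a) ^+ 2))) (f 1%N r * ((2 * r)^-1 * (2 * a))).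
  apply: (@is_derive_comp _ (f 0%N) (fun h => Num.sqrt (S + (1 * h + a) ^+ 2))) => //.
  by rewrite mulr0 add0r -Ex; exact: jf.
apply: is_derive_eq d4 _.
have r0 : r != 0 by rewrite /r Ex sqrtr_eq0 -ltNge.
rewrite -(jet_radialE r jf ef) /radial -/r; by field.
Qed.

(** Smoothness up to order n with weighted bounds. The recursion differentiates
    first in the coordinate that comes last in the list of pderiv: this order
    lets an induction replace F by its first derivatives. *)
Fixpoint bounded_smooth N n F (c : R) : Prop :=
  [/\ continuous F, forall i x, derivable F x (e_ i),
      forall x, (1 + enorm x) ^+ N * `|F x| <= c &
      if n is n'.+1 then forall i, bounded_smooth N n' (fun x => 'D_(e_ i) F x) c
      else True].

Lemma bounded_smooth_le N n F c c' : c <= c' ->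
  bounded_smooth N n F c -> bounded_smooth N n F c'.
Proof.
elim: n F => [|n IHn] F cc' /= [? ? Fc H]; split => //.
- by move=> x; apply: le_trans cc'.
- by move=> x; apply: le_trans cc'.
- by move=> i; apply: IHn.
Qed.

Lemma bounded_smoothP N n F c : bounded_smooth N n F c ->
  forall l, (size l <= n)%N -> [/\ continuous (pderiv l F),
    forall i x, derivable (pderiv l F) x (e_ i) &
    forall x, (1 + enorm x) ^+ N * `|pderiv l F x| <= c].
Proof.
elim: n F => [|n IHn] F /= [cF dF Fc H] l.
  by rewrite leqn0 size_eq0 => /eqP ->.
case/lastP: l => [//|l i]; rewrite size_rcons ltnS => ln.
by rewrite /pderiv foldr_rcons; exact: (IHn _ (H i)).
Qed.

Lemma bounded_smooth_add N n F G c d : bounded_smooth N n F c ->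
  bounded_smooth N n G d -> bounded_smooth N n (fun x => F x + G x) (c + d).
Proof.
elim: n F G => [|n IHn] F G [cF dF Fc HF] [cG dG Gd HG].
all: have cFG : continuous (fun x => F x + G x) by (move=> x; exact: (cvgD (cF x) (cG x))).
all: have dFG i x : is_derive x (e_ i) (fun x => F x + G x) ('D_(e_ i) F x + 'D_(e_ i) G x) by
  (apply: is_deriveD; exact: derivableP).
all: have bFG x : (1 + enorm x) ^+ N * `|F x + G x| <= c + d by
  (apply: le_trans (lerD (Fc x) (Gd x)); rewrite -mulrDr ler_wpM2l ?ler_normD//;
   rewrite exprn_ge0// addr_ge0// enorm_ge0).
- by split => // i x; case: (dFG i x).
- split => // i; rewrite (_ : (fun x => _) = (fun x => 'D_(e_ i) F x + 'D_(e_ i) G x)).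
    exact: (IHn _ _ (HF i) (HG i)).
  by apply/funext => x; case: (dFG i x).
Qed.

Lemma bounded_smooth_weaken N N' n n' F c : (N' <= N)%N -> (n' <= n)%N ->
  bounded_smooth N n F c -> bounded_smooth N' n' F c.
Proof.
move=> NN; elim: n' n F => [|n' IHn] [|n] F //= nn [cF dF Fc H].
- split => // x; apply: le_trans (Fc x); rewrite ler_wpM2r//.
  by rewrite ler_weXn2l// lerDl enorm_ge0.
- split => // x; apply: le_trans (Fc x); rewrite ler_wpM2r//.
  by rewrite ler_weXn2l// lerDl enorm_ge0.
- split => //.
    move=> x; apply: le_trans (Fc x); rewrite ler_wpM2r//.
    by rewrite ler_weXn2l// lerDl enorm_ge0.
  by move=> i; exact: IHn (H i).
Qed.

End RadialFunctions.

Section RadialBounds.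
Context {R : realType} {k : nat}.
Implicit Types (f g : nat -> R -> R) (F G : 'rV[R]_k -> R) (x : 'rV[R]_k) (i j : 'I_k).
Local Notation e_ i := (delta_mx (0 : 'I_1) (i : 'I_k) : 'rV[R]_k).

Lemma is_derive_coord x i j :
  is_derive x (e_ j) (fun x : 'rV[R]_k => x 0 i) ((i == j)%:R : R).
Proof.
apply: is_derive_line.
rewrite (_ : (fun h => _) = (fun h : R => (i == j)%:R * h + x 0 i)).
  exact: is_derive_affine.
by apply/funext => h; rewrite !mxE eqxx/= mulrC.
Qed.

Lemma bounded_smooth_ge0 N n F c : bounded_smooth N n F c -> 0 <= c.
Proof.
case: n => [|n] [_ _ /(_ 0) Fc _]; apply: le_trans Fc;
  by rewrite mulr_ge0// exprn_ge0// addr_ge0// enorm_ge0.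
Qed.

Lemma bounded_smooth_eq0 N n F : (forall x, F x = 0) -> bounded_smooth N n F 0.
Proof.
move=> F0; have {F0}-> : F = cst 0 by apply/funext.
elim: n => [|n IHn] /=.
- split => //; first exact: cst_continuous.
  by move=> x; rewrite normr0 mulr0.
- split => //; first exact: cst_continuous.
    by move=> x; rewrite normr0 mulr0.
  move=> i; rewrite (_ : (fun x => _) = cst 0)//.
  by apply/funext => x; rewrite derive_cst.
Qed.

(** Multiplication by a coordinate costs one power of the weight. *)
Lemma bounded_smooth_coord N n F c i : bounded_smooth N.+1 n F c ->
  bounded_smooth N n (fun x => x 0 i * F x) (n.+1%:R * c).
Proof.
elim: n F c => [|n IHn] F c Fs; have c0 := bounded_smooth_ge0 Fs; case: (Fs) => [cF dF Fc HF].
all: have cxF : continuous (fun x => x 0 i * F x) by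
   (move=> x; exact: (cvgM (@coord_continuous R _ _ 0 i x) (cF x))).
all: have dxF j x : is_derive x (e_ j) (fun x => x 0 i * F x) (x 0 i * 'D_(e_ j) F x + F x * (i == j)%:R) by
   (apply: is_deriveM; [exact: is_derive_coord|exact: derivableP]).
all: have bxF x : (1 + enorm x) ^+ N * `|x 0 i * F x| <= c by
   (apply: le_trans (Fc x); rewrite normrM mulrA exprSr ler_wpM2r// ler_wpM2l;
     [by []|by rewrite exprn_ge0// addr_ge0// enorm_ge0|by rewrite (le_trans (coord_le_enorm x i))// lerDr]).
- by split => // x; rewrite mul1r.
- split => //.
  + by move=> x; apply: le_trans (bxF x) _; rewrite ler_peMl// ler1n.
  + move=> j; rewrite (_ : (fun x => _) = (fun x => x 0 i * 'D_(e_ j) F x + F x * (i == j)%:R)); last first.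
      by apply/funext => x; case: (dxF j x).
    have -> : n.+2%:R * c = n.+1%:R * c + c by rewrite [n.+2%:R](natrD _ 1) addrC mulrDl mul1r addrC.
    apply: bounded_smooth_add; first exact: IHn _ _ (HF j).
    have [ij|ij] := eqVneq i j.
      rewrite (_ : (fun x => _) = F); last by apply/funext => x; rewrite /= mulr1.
      exact: bounded_smooth_weaken (leqnSn N) (leqnSn n) Fs.
    apply: (bounded_smooth_le c0); apply: bounded_smooth_eq0 => x.
    by rewrite mulr0.
Qed.

(** Each derivative of a radial function is a coordinate times the radial
    function of f'(r)/r: it costs one power of the weight for the coordinate and
    two derivatives of f. *)
Lemma bounded_smooth_radial n N : exists2 C : R, 0 <= C & forall f c, jet f -> even_jet f ->
  jet_bound (N + n) n.*2 f c -> bounded_smooth N n (@radial R k f) (C * c).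
Proof.
elim: n N => [|n IHn] N.
  exists 1 => // f c jf ef fc; split => //.
  - exact: continuous_radial.
  - by move=> i x; case: (is_derive_radial x i jf ef).
  - move=> x; rewrite mul1r; have := fc 0%N (enorm x) (leqnn _).
    by rewrite addn0 ger0_norm ?enorm_ge0.
have [C C0 HC] := IHn N.+1; have [D D0 HD] := @jet_bound_radial R (N + n.+1) n.*2.
exists (1 + n.+1%:R * (C * D)) => [|f c jf ef fc].
  by rewrite addr_ge0// !mulr_ge0.
have c0 := jet_bound_ge0 fc.
split.
- exact: continuous_radial.
- by move=> i x; case: (is_derive_radial x i jf ef).
- move=> x; apply: le_trans (_ : c <= _); last first.
    by rewrite mulrDl mul1r lerDl !mulr_ge0.
  have := fc 0%N (enorm x) (leq0n _); rewrite ger0_norm ?enorm_ge0//; apply: le_trans.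
  by rewrite ler_wpM2r// ler_weXn2l ?leq_addr// lerDl enorm_ge0.
- move=> i; rewrite (_ : (fun x => _) = (fun x => x 0 i * radial (jet_radial f) x)); last first.
    by apply/funext => x; case: (is_derive_radial x i jf ef).
  apply: (@bounded_smooth_le _ _ _ _ _ (n.+1%:R * (C * (D * c)))).
    by rewrite mulrDl mul1r !mulrA lerDr.
  apply: bounded_smooth_coord; apply: HC.
  + exact: jet_radialP.
  + exact: even_jet_radial.
  + by rewrite addSnnS; apply: HD.
Qed.

Definition schwartz_jet f := jet f /\ forall N n, exists c, jet_bound N n f c.

Lemma real_smooth_radial f : schwartz_jet f -> even_jet f -> real_smooth (@radial R k f).
Proof.
move=> [jf fb] ef l; have [C C0 HC] := bounded_smooth_radial (size l) 0.
have [c fc] := fb (0 + size l)%N (size l).*2.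
by have [] := bounded_smoothP (HC f c jf ef fc) (leqnn _).
Qed.

Lemma radial_bound N : exists2 C : R, 0 <= C & forall f c, jet f -> even_jet f ->
  jet_bound N.*2 N.*2 f c ->
  forall l x, (size l <= N)%N -> (1 + enorm x) ^+ N * `|pderiv l (@radial R k f) x| <= C * c.
Proof.
have [C C0 HC] := bounded_smooth_radial N N; exists C => // f c jf ef fc l x lN.
by have [] := bounded_smoothP (HC f c jf ef _) lN; rewrite ?addnn.
Qed.

End RadialBounds.

(** * Functions on the line *)

Section LineJets.
Context {R : realType}.
Implicit Types (phi : 'rV[R]_1 -> R[i]).

Definition line_jet (f : 'rV[R]_1 -> R) : nat -> R -> R :=
  fun n t => pderiv (nseq n ord0) f (const_mx t).

Lemma line_jetP f : real_smooth f -> jet (line_jet f).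
Proof.
move=> sf n t; have [_ /(_ ord0 (const_mx t)) d] := sf (nseq n ord0).
have E h : h *: (delta_mx 0 ord0 : 'rV[R]_1) + const_mx t = const_mx (h + t).
  by apply/rowP => i; rewrite !mxE ord1 !eqxx mulr1.
have F : (fun h : R => h^-1 *: ((pderiv (nseq n ord0) f \o shift (const_mx t)) (h *: delta_mx 0 ord0) - pderiv (nseq n ord0) f (const_mx t))) = (fun h : R => h^-1 *: ((line_jet f n \o shift t) (h *: 1) - line_jet f n t)).
  by apply/funext => h; rewrite /line_jet /= E /GRing.scale/= mulr1.
apply: DeriveDef.
  by move: d; rewrite /derivable F.
by rewrite /line_jet /= /derive F.
Qed.

Lemma enorm_const (t : R) : enorm (const_mx t : 'rV[R]_1) = `|t|.
Proof. by rewrite /enorm /dotp big_ord1 !mxE -expr2 sqrtr_sqr. Qed.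

Lemma const_mx_coord (x : 'rV[R]_1) : const_mx (x 0 0) = x.
Proof. by apply/rowP => i; rewrite mxE ord1. Qed.

Lemma pderiv_line (f : 'rV[R]_1 -> R) l x :
  pderiv l f x = line_jet f (size l) (x 0 0).
Proof.
rewrite /line_jet const_mx_coord; congr (pderiv _ f x).
by elim: l => //= i l {1}->; rewrite ord1.
Qed.

Lemma normr_Re_cmod (z : R[i]) : `|complex.Re z| <= cmod z.
Proof. by rewrite -sqrtr_sqr ler_sqrt ?lerDl ?sqr_ge0// addr_ge0// sqr_ge0. Qed.

Lemma normr_Im_cmod (z : R[i]) : `|complex.Im z| <= cmod z.
Proof. by rewrite -sqrtr_sqr ler_sqrt ?lerDr ?sqr_ge0// addr_ge0// sqr_ge0. Qed.

Lemma cmod_le (z : R[i]) : cmod z <= `|complex.Re z| + `|complex.Im z|.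
Proof.
rewrite /cmod -[leRHS]ger0_norm ?addr_ge0// -sqrtr_sqr ler_sqrt ?sqr_ge0//.
rewrite sqrrD !real_normK ?num_real// lerD2r lerDl.
by rewrite mulrn_wge0// mulr_ge0.
Qed.

Lemma schwartz_bound_jets N phi M : schwartz_bound N phi M ->
  jet_bound N N (line_jet (re_part phi)) M /\ jet_bound N N (line_jet (im_part phi)) M.
Proof.
move=> pM; split => j t jN; have := pM (nseq j ord0) (const_mx t);
  rewrite size_nseq enorm_const => /(_ jN); apply: le_trans; rewrite ler_wpM2l ?exprn_ge0 ?addr_ge0//.
- exact: le_trans (normr_Re_cmod _).
- exact: le_trans (normr_Im_cmod _).
Qed.

Lemma schwartz_jets phi : schwartz phi ->
  schwartz_jet (line_jet (re_part phi)) /\ schwartz_jet (line_jet (im_part phi)).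
Proof.
move=> [[s1 s2] pb]; split; (split; first exact: line_jetP) => N n;
  have [M /schwartz_bound_jets[b1 b2]] := pb (maxn N n); exists M;
  [apply: jet_bound_leq b1|apply: jet_bound_leq b2]; by rewrite ?leq_maxl ?leq_maxr.
Qed.

End LineJets.

(** * Iterates of the operator f'(r)/r in closed form *)

Section ClosedFormula.
Context {R : realType}.
Implicit Types (f g h : nat -> R -> R) (r : R) (p j m n : nat).

(** Coefficients of the operator (1/r d/dr)^p applied to g(r)/r. *)
Fixpoint quot_coef p j : R :=
  match p with
  | 0 => (j == 0%N)%:R
  | p'.+1 => (j%:R - (p'.*2.+1)%:R) * quot_coef p' j +
             (if j is j'.+1 then quot_coef p' j' else 0)
  end.

Lemma quot_coef_gt p j : (p < j)%N -> quot_coef p j = 0.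
Proof.
elim: p j => [|p IHp] [|j]//= pj.
by rewrite !IHp ?mulr0 ?addr0// ltnW.
Qed.

(** The closed form satisfies the recursion that defines quot_coef; with
    m = p - j no truncated subtraction occurs. *)
Lemma quot_coefE j m : quot_coef (j + m) j =
  (-1) ^+ m * (j + m.*2)`!%:R / (j`!%:R * 2 ^+ m * m`!%:R).
Proof.
move Ep : (j + m)%N => p; elim: p j m Ep => [|p IHp] j m.
  by move/eqP; rewrite addn_eq0 => /andP[/eqP -> /eqP ->]; rewrite /= !fact0 !expr0; field.
have fN0 n : n`!%:R != 0 :> R by rewrite pnatr_eq0 -lt0n fact_gt0.
have tN0 n : 2 ^+ n != 0 :> R by rewrite expf_neq0.
have rS n : n.+1%:R = n%:R + 1 :> R by rewrite natr1.
have rD n : n.*2%:R = 2 * n%:R :> R by rewrite -mul2n natrM.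
have rSN0 n : n%:R + 1 != 0 :> R by rewrite natr1 pnatr_eq0.
case: m => [|m].
  rewrite addn0 => -> /=; rewrite quot_coef_gt// mulr0 add0r.
  rewrite (IHp p 0%N) ?addn0// !expr0 fact0 !mul1r !mulr1 !divff//.
rewrite addnS => -[jm]; case: j jm => [|j] jm.
  rewrite /= (IHp _ _ jm) -jm !add0n doubleS !factS !exprS !natrM fact0.
  rewrite [m.*2.+2%:R]rS [m.*2.+1%:R]rS [m.+1%:R]rS rD; field.
  by rewrite fN0 tN0 rSN0.
rewrite [LHS]/= (IHp _ _ jm) (IHp j m.+1); last by rewrite -jm addSnnS.
rewrite doubleS !addnS !addSn !factS !exprS !natrM -jm.
rewrite !rS !natrD !rD !rS natrD; field.
have -> : 0 + 1 + 1 = 2 :> R by rewrite add0r.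
by rewrite !fN0 tN0 !rSN0.
Qed.

(** With h the p-th iterate, the induction step is the identity
    r^(2p+3) h'(r)/r = r (r^(2p+1) h(r))' - (2p+1) r^(2p+1) h(r), the
    right-hand side of which is known from the sum for p. *)
Lemma iter_radial_quotE p g r : jet g -> g 0%N 0 = 0 -> even_jet (jet_quot g) ->
  r ^+ p.*2.+1 * iter p jet_radial (jet_quot g) 0 r =
  \sum_(j < p.+1) quot_coef p j * (r ^+ j * g j r).
Proof.
move=> jg g0 eq; have jq := jet_quotP jg.
elim: p r => [|p IHp] r.
  by rewrite /= big_ord1 expr1 expr0 !mul1r jet_quotE// g0 subr0.
set h := iter p _ _ in IHp *.
have jh : jet h by exact: jet_iter_radialP.
have eh : even_jet h by exact: even_jet_iter_radial.
have dX n : is_derive r 1 (fun r : R => r ^+ n) (n%:R * r ^+ n.-1).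
  have := is_deriveX n (is_derive_id_fun r); rewrite /GRing.scale/= mulr1.
  by congr (is_derive _ _ _ _); apply/funext => s; rewrite exprfctE.
have d1 : is_derive r 1 (fun r => r ^+ p.*2.+1 * h 0%N r) (r ^+ p.*2.+1 * h 1%N r + h 0%N r * (p.*2.+1%:R * r ^+ p.*2)).
  by apply: is_derive_mul => //; exact: dX.
have d2 : is_derive r 1 (fun r => \sum_(j < p.+1) quot_coef p j * (r ^+ j * g j r))
   (\sum_(j < p.+1) quot_coef p j * (r ^+ j * g j.+1 r + g j r * (j%:R * r ^+ j.-1))).
  rewrite (_ : (fun r => _) = \sum_(j < p.+1) (fun r => quot_coef p j * (r ^+ j * g j r))); last first.
    by apply/funext => s; rewrite fct_sumE.
  apply: is_derive_sum => j; apply: is_derive_scale.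
  exact: (is_derive_mul (dX j) (jg j r)).
have E : r ^+ p.*2.+1 * h 1%N r + h 0%N r * (p.*2.+1%:R * r ^+ p.*2) =
  \sum_(j < p.+1) quot_coef p j * (r ^+ j * g j.+1 r + g j r * (j%:R * r ^+ j.-1)).
  apply: (is_derive_unique d1).
  have -> : (fun r => r ^+ p.*2.+1 * h 0%N r) =
      (fun r => \sum_(j < p.+1) quot_coef p j * (r ^+ j * g j r)) by apply/funext.
  exact: d2.
have -> : r ^+ p.+1.*2.+1 * iter p.+1 jet_radial (jet_quot g) 0 r =
   r * (\sum_(j < p.+1) quot_coef p j * (r ^+ j * g j.+1 r + g j r * (j%:R * r ^+ j.-1))) - p.*2.+1%:R * (\sum_(j < p.+1) quot_coef p j * (r ^+ j * g j r)).
  rewrite -E -IHp -(jet_radialE r jh eh) doubleS !exprS /=; ring.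
rewrite !mulr_sumr -sumrB.
transitivity (\sum_(j < p.+1) ((j%:R - p.*2.+1%:R) * quot_coef p j * (r ^+ j * g j r)) +
  \sum_(j < p.+1) quot_coef p j * (r ^+ j.+1 * g j.+1 r)).
  rewrite -big_split/=; apply: eq_bigr => j _.
  have -> : r * (quot_coef p j * (r ^+ j * g j.+1 r + g j r * (j%:R * r ^+ j.-1))) =
    quot_coef p j * (r ^+ j.+1 * g j.+1 r + g j r * (j%:R * r ^+ j)).
    by case: (nat_of_ord j) => [|j']; rewrite ?mul0r ?mulr0 ?addr0 /= ?exprS; ring.
  by ring.
rewrite [RHS](eq_bigr (fun j : 'I_p.+2 => (j%:R - p.*2.+1%:R) * quot_coef p j * (r ^+ j * g j r) +
   (if nat_of_ord j is j'.+1 then quot_coef p j' else 0) * (r ^+ j * g j r))); last first.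
  by move=> j _; rewrite /= mulrDl.
rewrite big_split/=; congr (_ + _).
  by rewrite [RHS]big_ord_recr/= quot_coef_gt// mulr0 mul0r addr0.
by rewrite [RHS]big_ord_recl/= mul0r add0r.
Qed.

Lemma dfact_double m : (dfact m.*2)%:R = 2 ^+ m * m`!%:R :> R.
Proof.
elim: m => [|m IHm]; first by rewrite /= expr0 mul1r.
by rewrite doubleS [dfact _]/= natrM IHm factS natrM exprS -doubleS -mul2n natrM; ring.
Qed.

Lemma dfact_gt0 m : (0 < dfact m)%N.
Proof.
suff : (0 < dfact m)%N && (0 < dfact m.+1)%N by case/andP.
by elim: m => [|m /andP[m0 m1]]//; rewrite m1 /= muln_gt0 m0.
Qed.

(** The operator h'(r)/r turns the Taylor coefficient a_n of r^n into the
    coefficient n a_n of r^(n-2), so that p steps multiply a_(2p) by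
    2p (2p-2) ... 2; expressed through h^(2p)(0) this is 1/(2p-1)!!. *)
Lemma iter_radial0 p h : jet h ->
  (dfact p.*2.+1)%:R * iter p jet_radial h 0 0 = p.*2.+1%:R * h p.*2 0.
Proof.
elim: p h => [|p IHp] h jh; first by [].
rewrite iterSr doubleS.
have -> : (dfact p.*2.+3)%:R = p.*2.+3%:R * (dfact p.*2.+1)%:R :> R by rewrite -natrM.
rewrite -mulrA IHp; last exact: jet_radialP.
rewrite /jet_radial jet_quot0; last exact: jet_shiftP.
by congr (_ * _); rewrite /jet_shift mulrC divfK// pnatr_eq0.
Qed.

Lemma iter_radial_quot0 p g : jet g ->
  (dfact p.*2.+1)%:R * iter p jet_radial (jet_quot g) 0 0 = g p.*2.+1 0.
Proof.
move=> jg; rewrite iter_radial0; last exact: jet_quotP.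
by rewrite jet_quot0// mulrC divfK// pnatr_eq0.
Qed.

End ClosedFormula.

(** * The two radial lifts *)

Section Transforms.
Context {R : realType} {k : nat}.
Implicit Types (phi : 'rV[R]_1 -> R[i]) (x : 'rV[R]_k) (r : R).

(** The radial function on R^k with which the pairing of the measure is the
    pairing of sigma with phi. *)
Definition odd_lift phi x : R[i] :=
  if x == 0 then - 2 * ddelta 1 0 phi
  else (ddelta 0 (enorm x) phi - ddelta 0 (- enorm x) phi) / (enorm x)%:C.

(** The radial function on R^k with which the pairing of the Fourier transform
    of the measure is the pairing of sigma_hat with phi. *)
Definition spectral_lift phi x : R[i] :=
  if x == 0 then 2 * 'i%C * (alpha k)%:C * ddelta (k - 2) 0 phi
  else - 'i%C * ((\sum_(0 <= j < (k - 3)./2.+1) (beta k j)%:C * (enorm x)%:C ^+ j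
           * ((-1) ^+ j * ddelta j (enorm x) phi - ddelta j (- enorm x) phi))
           / (enorm x)%:C ^+ (k - 2)).

Definition re_jet phi := line_jet (re_part phi).
Definition im_jet phi := line_jet (im_part phi).

Lemma mul_real_complex (a u v : R) : a%:C * (u +i* v) = (a * u) +i* (a * v).
Proof. by rewrite /GRing.mul/= !mul0r subr0 addr0. Qed.

Lemma mul_imaginary (a u v : R) : (0 +i* a) * (u +i* v) = (- (a * v)) +i* (a * u).
Proof. by rewrite /GRing.mul/= !mul0r sub0r add0r. Qed.

Lemma add_complexE (u v u' v' : R) : (u +i* v) + (u' +i* v') = (u + u') +i* (v + v').
Proof. by []. Qed.

Lemma opp_complexE (u v : R) : - (u +i* v) = (- u) +i* (- v).
Proof. by []. Qed.

Lemma sum_complexE n (u v : nat -> R) :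
  \sum_(0 <= j < n) (u j +i* v j) = (\sum_(0 <= j < n) u j) +i* (\sum_(0 <= j < n) v j).
Proof.
elim: n => [|n IHn]; first by rewrite !big_nil.
by rewrite !big_nat_recr//= IHn add_complexE.
Qed.

Lemma real_complexX (a : R) n : (a ^+ n)%:C = a%:C ^+ n.
Proof. exact: rmorphXn. Qed.

Lemma real_complexV (a : R) : (a^-1)%:C = (a%:C)^-1.
Proof. exact: fmorphV. Qed.

Lemma sign_sqr j : (-1) ^+ j * (-1) ^+ j = 1 :> R.
Proof. by rewrite -exprD addnn -mul2n exprM sqrrN !expr1n. Qed.

Lemma ddeltaE j (t : R) phi :
  ddelta j t phi = ((-1) ^+ j * re_jet phi j t) +i* ((-1) ^+ j * im_jet phi j t).
Proof.
rewrite /ddelta /cpderiv -mul_real_complex real_complexX; congr (_ ^+ j * _).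
by rewrite [RHS]rmorphN.
Qed.

Lemma ddelta_diffE j (r : R) phi :
  (-1) ^+ j * ddelta j r phi - ddelta j (- r) phi =
  (jet_odd (re_jet phi) j r) +i* (jet_odd (im_jet phi) j r).
Proof.
rewrite !ddeltaE (_ : (-1) ^+ j = ((-1 : R) ^+ j)%:C); last first.
  by rewrite real_complexX; congr (_ ^+ j); rewrite [RHS]rmorphN.
by rewrite mul_real_complex !mulrA !sign_sqr !mul1r.
Qed.

Lemma jet_odd_at0 (f : nat -> R -> R) : jet_odd f 0 0 = 0.
Proof. by rewrite /jet_odd expr0 oppr0 mul1r subrr. Qed.

Lemma jet_quot_oddE (f : nat -> R -> R) (r : R) : jet f -> r != 0 ->
  jet_quot (jet_odd f) 0 r = (f 0%N r - f 0%N (- r)) / r.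
Proof.
move=> jf r0; apply: (mulfI r0); rewrite jet_quotE; last exact: jet_oddP.
by rewrite jet_odd_at0 subr0 mulrC divfK// /jet_odd expr0 mul1r.
Qed.

(** The quotient of the odd part has the value 2 phi'(0) at the origin, which
    is where the term -2 delta'_0 of sigma comes from. *)
Lemma odd_liftE phi x : smooth phi ->
  odd_lift phi x = (radial (jet_quot (jet_odd (re_jet phi))) x) +i*
                   (radial (jet_quot (jet_odd (im_jet phi))) x).
Proof.
move=> [/line_jetP j1 /line_jetP j2]; rewrite /odd_lift /radial.
case: eqVneq => [->|xN0].
  rewrite enorm0 !jet_quot0; [|exact: jet_oddP..].
  rewrite !divr1 ddeltaE expr1 !mulN1r (_ : - 2 = (- 2 : R)%:C); last first.
    by rewrite rmorphN rmorph_nat.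
  rewrite mul_real_complex /jet_odd oppr0 expr1 !mulN1r !opprK.
  by congr (_ +i* _); rewrite mulNr mulrN opprK mulr_natl mulr2n.
have r0 : enorm x != 0 by rewrite enorm_eq0.
rewrite -(mul1r (ddelta 0 (enorm x) phi)) -(expr0 (-1)) ddelta_diffE mulrC -real_complexV.
rewrite mul_real_complex !jet_quot_oddE//.
by rewrite /jet_odd !expr0 !mul1r [X in X +i* _]mulrC [X in _ +i* X]mulrC.
Qed.

Section Coefficients.
Variable p : nat.
Hypothesis kE : k = p.*2.+3.

(** The scalar by which (-1/(2 pi r) d/dr)^p differs from (1/r d/dr)^p. *)
Definition spectral_const : R := (- (1 / (2 * pi))) ^+ p.

Lemma half_dim : (k - 3)./2 = p.
Proof. by rewrite kE subSS subSS subSS subn0 doubleK. Qed.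

Lemma spectral_constE : spectral_const = (-1) ^+ p * (1 / (2 * pi)) ^+ p.
Proof. by rewrite -exprMn mulN1r. Qed.

Lemma spectral_const_alpha : spectral_const = alpha k * (dfact p.*2.+1)%:R.
Proof.
rewrite /alpha half_dim kE subSS subSS subn0 spectral_constE.
by rewrite [RHS]mulrAC divfK// pnatr_eq0 -lt0n dfact_gt0.
Qed.

Lemma spectral_const_beta j : (j <= p)%N -> beta k j = spectral_const * quot_coef p j.
Proof.
move=> jp; rewrite /beta half_dim kE spectral_constE.
have -> : (p.*2.+3 - j - 3 = j + (p - j).*2)%N by lia.
have -> : (p.*2.+3 - 2 * j - 3 = (p - j).*2)%N by lia.
have -> : quot_coef p j = quot_coef (j + (p - j)) j by rewrite subnKC.
have -> : (-1) ^+ p = (-1) ^+ j * (-1) ^+ (p - j) :> R by rewrite -exprD subnKC.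
rewrite quot_coefE dfact_double.
have fN0 n : n`!%:R != 0 :> R by rewrite pnatr_eq0 -lt0n fact_gt0.
have tN0 : 2 ^+ (p - j) != 0 :> R by rewrite expf_neq0.
have s1 := sign_sqr (p - j).
rewrite [RHS](_ : _ = (-1) ^+ j * ((-1) ^+ (p - j) * (-1) ^+ (p - j)) *
  ((j + (p - j).*2)`!%:R / (j`!%:R * 2 ^+ (p - j) * (p - j)`!%:R)) * (1 / (2 * pi)) ^+ p).
  by rewrite s1 mulr1 !mulrA.
by ring.
Qed.

(** The sum over j with the coefficients beta is the expansion of
    (1/r d/dr)^p (phi(r) - phi(-r))/r; the factor -i exchanges real and
    imaginary parts. *)
Lemma spectral_liftE phi x : smooth phi ->
  spectral_lift phi x =
  (spectral_const * radial (iter p jet_radial (jet_quot (jet_odd (im_jet phi)))) x) +i*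
  (- (spectral_const * radial (iter p jet_radial (jet_quot (jet_odd (re_jet phi)))) x)).
Proof.
move=> [/line_jetP j1 /line_jetP j2]; rewrite /spectral_lift /radial.
rewrite -/(re_jet phi) in j1; rewrite -/(im_jet phi) in j2.
case: eqVneq => [->|xN0].
  have sN : (-1) ^+ p.*2.+1 = -1 :> R by rewrite exprS -addnn exprD sign_sqr mulr1.
  have odd0 (f : nat -> R -> R) : jet f ->
      spectral_const * iter p jet_radial (jet_quot (jet_odd f)) 0 0 = alpha k * (2 * f p.*2.+1 0).
    move=> jf; rewrite spectral_const_alpha -mulrA iter_radial_quot0; last exact: jet_oddP.
    by rewrite /jet_odd sN oppr0 mulN1r opprK mulr_natl mulr2n.
  rewrite enorm0 [X in _ = X +i* _](odd0 _ j2) [X in _ = _ +i* - X](odd0 _ j1).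
  rewrite ddeltaE (_ : (k - 2 = p.*2.+1)%N); last by rewrite kE subSS subSS subn0.
  rewrite sN !mulN1r.
  rewrite (_ : 2 * 'i%C * (alpha k)%:C = 0 +i* (2 * alpha k)); last first.
    by rewrite mulrC (_ : 2 * 'i%C = 0 +i* 2) ?mul_real_complex ?mulr0 ?[_ * 2]mulrC// -(rmorph_nat (real_complex R)) mul_real_complex mulr0 mulr1.
  by rewrite mul_imaginary; congr (_ +i* _); ring.
have r0 : enorm x != 0 by rewrite enorm_eq0.
set r := enorm x in r0 *.
have inner (f : nat -> R -> R) : jet f ->
    \sum_(0 <= j < p.+1) beta k j * r ^+ j * jet_odd f j r =
    spectral_const * (r ^+ p.*2.+1 * iter p jet_radial (jet_quot (jet_odd f)) 0 r).
  move=> jf; rewrite iter_radial_quotE; [|exact: jet_oddP|exact: jet_odd_at0|exact: even_jet_quot_odd].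
  rewrite mulr_sumr big_mkord; apply: eq_bigr => j _.
  by rewrite spectral_const_beta; [rewrite !mulrA|rewrite -ltnS].
rewrite half_dim (_ : (k - 2 = p.*2.+1)%N); last by rewrite kE subSS subSS subn0.
rewrite (_ : \sum_(0 <= j < p.+1) _ =
  (\sum_(0 <= j < p.+1) beta k j * r ^+ j * jet_odd (re_jet phi) j r) +i*
  (\sum_(0 <= j < p.+1) beta k j * r ^+ j * jet_odd (im_jet phi) j r)); last first.
  rewrite -sum_complexE; apply: eq_bigr => j _.
  by rewrite ddelta_diffE -mulrA -real_complexX !mul_real_complex !mulrA.
rewrite !inner// [X in _ * X]mulrC -real_complexX -real_complexV mul_real_complex.
rewrite (_ : - 'i%C = 0 +i* -1); last by rewrite opp_complexE oppr0.
rewrite mul_imaginary; have rn0 : r ^+ p.*2.+1 != 0 by rewrite expf_neq0.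
by congr (_ +i* _); field.
Qed.

End Coefficients.

End Transforms.

(** * Even primitives and trigonometric integrals *)

Section OddPrimitive.
Context {R : realType}.
Local Notation mu := (@lebesgue_measure R).
Implicit Types (f g : nat -> R -> R) (a b c r s t x B : R) (n : nat).

Definition jet_vanish B f := forall n t, B < `|t| -> f n t = 0.

Lemma jet_vanishP B f : jet f -> (forall t, B < `|t| -> f 0%N t = 0) ->
  jet_vanish B f.
Proof.
move=> jf f0; elim=> [|n IHn] t Bt; first exact: f0.
apply: (is_derive_unique (jf n t)).
apply: (@near_eq_is_derive _ _ _ (cst 0)).
near=> s; rewrite IHn//; near: s.
by apply: (cvgr_gt `|t|) => //; exact: norm_continuous.
Unshelve. all: by end_near. Qed.

Lemma jet_vanish_radial B f : 0 <= B -> jet f -> even_jet f -> jet_vanish B f ->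
  jet_vanish B (jet_radial f).
Proof.
move=> B0 jf ef fB; apply: jet_vanishP; first exact: jet_radialP.
move=> t Bt; have t0 : t != 0.
  by apply/eqP => t0; rewrite t0 normr0 ltNge B0 in Bt.
by apply: (mulfI t0); rewrite jet_radialE// fB// mulr0.
Qed.

Lemma jet_vanish_iter_radial B f p : 0 <= B -> jet f -> even_jet f -> jet_vanish B f ->
  jet_vanish B (iter p jet_radial f).
Proof.
move=> B0 jf ef fB; elim: p => //= p IHp.
by apply: jet_vanish_radial => //; [exact: jet_iter_radialP|exact: even_jet_iter_radial].
Qed.

Lemma jet_vanish_out B f n (g : R -> R) : jet_vanish B f ->
  vanish_out (- (B + 1)) (B + 1) (fun t => f n t * g t).
Proof.
move=> fB t; rewrite -ltr_norml -leNgt => Bt; rewrite fB ?mul0r//.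
by rewrite (lt_le_trans _ Bt)// ltrDl.
Qed.

Lemma jet_odd_vanish B f : jet_vanish B f -> jet_vanish B (jet_odd f).
Proof. by move=> fB n t Bt; rewrite /jet_odd !fB ?normrN// mulr0 subr0. Qed.

(** The primitive that vanishes on the far left is even, since the integrand is
    odd, and therefore vanishes on the far right as well. *)
Lemma odd_primitive B f : 0 <= B -> jet f -> jet_vanish B f ->
  exists P, [/\ jet P, even_jet P, jet_vanish B P & jet_shift P = jet_odd f].
Proof.
move=> B0 jf fB; have jo := jet_oddP jf; have oB := jet_odd_vanish fB.
have co := jet_continuous jo 0%N.
have v : vanish_out (- (B + 1)) (B + 1) (jet_odd f 0).
  move=> t tB; have := jet_vanish_out 0 (cst 1) oB tB.
  by rewrite /= mulr1.
have [F dF] := exists_primitive co v.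
pose P n := if n is n'.+1 then jet_odd f n' else fun x => F x - F (- (B + 1)).
have jP : jet P.
  case=> [|n] x; last exact: jo.
  by rewrite -[X in is_derive _ _ _ X]addr0; apply: is_derive_add => //; exact: is_derive_cst_fun.
have eP : even_jet P.
  move=> x; rewrite /P; congr (_ - _).
  apply/eqP; rewrite -subr_eq0; apply/eqP.
  have d (y : R) : is_derive y 1 (fun y => F (-1 * y + 0) + - F y) (0 : R).
    have := is_derive_add (is_derive_comp_affine (dF (-1 * y + 0))) (is_derive_opp (dF y)).
    congr (is_derive _ _ _ _).
    by rewrite addr0 !mulN1r /jet_odd expr0 !mul1r opprK; ring.
  have := is_derive_0_is_cst x 0 d.
  by rewrite mulr0 !addr0 mulN1r subrr.
exists P; split => //; apply: jet_vanishP => // t.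
wlog t0 : t / t <= 0.
  move=> h Bt; have [t0|t0] := leP t 0; first exact: h.
  by rewrite -eP h ?normrN// oppr_le0 ltW.
rewrite ler0_norm// => Bt; rewrite /P.
have [tB|tB] := ltP t (- (B + 1)).
  rewrite -[X in _ = X]oppr0 -opprB -(integral_itv_primitive tB co (fun x _ => dF x) (is_derive_continuous dF)).
  congr (- _); under eq_Rintegral.
    move=> x; rewrite inE/= in_itv/= => /andP[_ xB]; rewrite oB; last first.
      rewrite ler0_norm; last by apply: le_trans xB _; rewrite oppr_le0 addr_ge0.
      by rewrite ltrNr (le_lt_trans xB)// ltrN2 ltrDl.
    over.
  by rewrite Rintegral_cst//= mul0r.
move: tB; rewrite le_eqVlt => /predU1P[<-|tB]; first by rewrite subrr.
rewrite -(integral_itv_primitive tB co (fun x _ => dF x) (is_derive_continuous dF)).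
under eq_Rintegral.
  move=> x; rewrite inE/= in_itv/= => /andP[_ xt]; rewrite oB; last first.
    by rewrite ler0_norm ?(le_trans xt)// (lt_le_trans Bt)// lerN2.
  over.
by rewrite Rintegral_cst//= mul0r.
Qed.

Definition cosint (g : R -> R) c := \int[mu]_t (g t * cos (c * t)).
Definition sinint (g : R -> R) c := \int[mu]_t (g t * sin (c * t)).

Lemma is_derive_cos_mul c t : is_derive t 1 (fun t : R => cos (c * t)) (- (c * sin (c * t))).
Proof.
have := @is_derive_comp_affine R cos t c 0 _ (is_derive_cos (c * t + 0)).
rewrite addr0 mulrN; congr (is_derive _ _ _ _).
by apply/funext => s; rewrite addr0.
Qed.

Lemma is_derive_sin_mul c t : is_derive t 1 (fun t : R => sin (c * t)) (c * cos (c * t)).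
Proof.
have := @is_derive_comp_affine R sin t c 0 _ (is_derive_sin (c * t + 0)).
rewrite addr0; congr (is_derive _ _ _ _).
by apply/funext => s; rewrite addr0.
Qed.

Lemma continuous_cos_mul c : continuous (fun t : R => cos (c * t)).
Proof. exact: is_derive_continuous (is_derive_cos_mul c). Qed.

Lemma continuous_sin_mul c : continuous (fun t : R => sin (c * t)).
Proof. exact: is_derive_continuous (is_derive_sin_mul c). Qed.

Lemma continuous_mul (u v : R -> R) : continuous u -> continuous v ->
  continuous (fun t => u t * v t).
Proof. by move=> cu cv t; exact: (cvgM (cu t) (cv t)). Qed.

Lemma integrable_jet_mul B f n (g : R -> R) : jet f -> jet_vanish B f -> continuous g ->
  mu.-integrable setT (EFin \o (fun t => f n t * g t)).
Proof.
move=> jf fB cg; apply: integrable_vanish_out (jet_vanish_out n g fB).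
by apply: continuous_mul => //; exact: jet_continuous.
Qed.

Lemma integral_reflect B f n (g : R -> R) : jet f -> jet_vanish B f -> continuous g ->
  \int[mu]_t (f n (- t) * g (- t)) = \int[mu]_t (f n t * g t).
Proof.
move=> jf fB cg.
have cfg : continuous (fun t => f n t * g t) by apply: continuous_mul => //; exact: jet_continuous.
have N1 : (-1 : R) != 0 by rewrite oppr_eq0 oner_eq0.
rewrite -(integral_affine 0 cfg (jet_vanish_out n g fB) N1).
by apply: eq_Rintegral => t _; rewrite normrN1 mul1r addr0 mulN1r.
Qed.

Lemma integral_jet_odd B f (g : R -> R) : jet f -> jet_vanish B f -> continuous g ->
  (forall t, g (- t) = - g t) ->
  \int[mu]_t (jet_odd f 0 t * g t) = 2 * \int[mu]_t (f 0%N t * g t).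
Proof.
move=> jf fB cg go.
transitivity (\int[mu]_t (f 0%N t * g t + f 0%N (- t) * g (- t))).
  by apply: eq_Rintegral => t _; rewrite /jet_odd expr0 mul1r go mulrBl mulrN.
have i1 := integrable_jet_mul 0 jf fB cg.
have i2 : mu.-integrable setT (EFin \o (fun t => f 0%N (- t) * g (- t))).
  have v : vanish_out (- (B + 1)) (B + 1) (fun t => f 0%N (- t) * g (- t)).
    move=> t tB; apply: (jet_vanish_out 0 g fB); apply: contra tB.
    by rewrite -!ltr_norml normrN.
  apply: integrable_vanish_out v => t.
  have cN : {for t, continuous (fun t : R => - t)} by apply: cvgN; exact: cvg_id.
  apply: cvgM.
    by apply: (@continuous_comp _ _ _ -%R (f 0%N)) => //; exact: jet_continuous.
  by apply: (@continuous_comp _ _ _ -%R g) => //; exact: cg.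
by rewrite RintegralD// (integral_reflect 0 jf fB cg) mulr_natl mulr2n.
Qed.

Lemma sinint_even B P c : jet P -> jet_vanish B P -> even_jet P ->
  sinint (P 0%N) c = 0.
Proof.
move=> jP PB eP; apply/eqP; rewrite -[_ == 0](mulrn_eq0 _ 2) mulr2n.
rewrite {1}/sinint -(integral_reflect 0 jP PB (@continuous_sin_mul c)).
rewrite /sinint -RintegralD//=.
- under eq_Rintegral do rewrite eP mulrN sinN mulrN addNr.
  by rewrite Rintegral_cst// mul0r.
- have -> : (fun t => P 0%N (- t) * sin (c * - t)) = (fun t => P 0%N t * - sin (c * t)).
    by apply/funext => t; rewrite eP mulrN sinN.
  apply: (integrable_jet_mul 0 jP PB) => t; apply: cvgN; exact: continuous_sin_mul.
- exact: (integrable_jet_mul 0 jP PB (@continuous_sin_mul c)).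
Qed.

(** The boundary terms vanish with P. *)
Lemma integral_jet_parts B P (g g' : R -> R) : 0 <= B -> jet P -> jet_vanish B P ->
  (forall t, is_derive t 1 g (g' t)) -> continuous g' ->
  \int[mu]_t (P 0%N t * g' t) = - \int[mu]_t (P 1%N t * g t).
Proof.
move=> B0 jP PB dg cg'; have cg := is_derive_continuous dg.
apply/eqP; rewrite -addr_eq0 -RintegralD//; last 2 first.
- exact: (integrable_jet_mul 0 jP PB cg').
- exact: (integrable_jet_mul 1 jP PB cg).
have d t : is_derive t 1 (fun t => P 0%N t * g t) (P 0%N t * g' t + P 1%N t * g t).
  by rewrite [P 1%N t * _]mulrC; apply: is_derive_mul => //; exact: jP.
have c0 : continuous (fun t => P 0%N t * g' t + P 1%N t * g t).
  move=> t; apply: cvgD; exact: (continuous_mul (jet_continuous jP _)).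
have v : vanish_out (- (B + 1)) (B + 1) (fun t => P 0%N t * g' t + P 1%N t * g t).
  by move=> t tB; rewrite (jet_vanish_out 0 g' PB tB) (jet_vanish_out 1 g PB tB) addr0.
have BB : - (B + 1) < B + 1 by rewrite gt0_cp// ltr_wpDl.
rewrite (integral_primitive BB c0 v d) !PB ?mul0r ?subrr// ?normrN gtr0_norm ?ltrDl// ltr_wpDl//.
Qed.

(** Integration by parts: P is a primitive of f(t) - f(-t), against which sin
    counts f twice. *)
Lemma cosint_primitive B f P c : 0 <= B -> jet f -> jet_vanish B f -> jet P ->
  jet_vanish B P -> jet_shift P = jet_odd f ->
  c * cosint (P 0%N) c = - 2 * sinint (f 0%N) c.
Proof.
move=> B0 jf fB jP PB Pf.
rewrite /cosint -RintegralZl//; last exact: (integrable_jet_mul 0 jP PB (@continuous_cos_mul c)).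
transitivity (\int[mu]_t (P 0%N t * (c * cos (c * t)))).
  by apply: eq_Rintegral => t _; rewrite mulrCA.
rewrite (integral_jet_parts B0 jP PB (is_derive_sin_mul c)); last first.
  by apply: continuous_mul; [exact: cst_continuous|exact: continuous_cos_mul].
rewrite -/(jet_shift P 0%N) Pf (integral_jet_odd jf fB (@continuous_sin_mul c)) ?mulNr// => t.
by rewrite mulrN sinN.
Qed.

(** At frequency zero one integrates by parts against t in place of sin. *)
Lemma cosint_primitive0 B f P : 0 <= B -> jet f -> jet_vanish B f -> jet P ->
  jet_vanish B P -> jet_shift P = jet_odd f ->
  cosint (P 0%N) 0 = - 2 * \int[mu]_t (f 0%N t * t).
Proof.
move=> B0 jf fB jP PB Pf.
transitivity (\int[mu]_t (P 0%N t * 1)).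
  by apply: eq_Rintegral => t _; rewrite mul0r cos0.
have ci : continuous (fun t : R => t) by move=> t; exact: cvg_id.
rewrite (integral_jet_parts B0 jP PB (@is_derive_id_fun R)); last exact: cst_continuous.
by rewrite -/(jet_shift P 0%N) Pf (integral_jet_odd jf fB ci) ?mulNr.
Qed.

Lemma is_derive_trigint B f (u u' : R -> R -> R) : jet f -> jet_vanish B f ->
  (forall c t, is_derive c 1 (fun c => u c t) (t * u' c t)) ->
  (forall c, continuous (u c)) -> (forall c t, `|u' c t| <= 1) ->
  is_derive (0 : R) 1 (fun c => \int[mu]_t (f 0%N t * u c t))
                      (\int[mu]_t (f 0%N t * (t * u' 0 t))).
Proof.
move=> jf fB du cu u1.
have v c := jet_vanish_out 0 (u c) fB.
have v' c := jet_vanish_out 0 (fun t => t * u' c t) fB.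
rewrite (integral_vanish_out (v' 0)).
rewrite (_ : (fun c => _) = (fun c => \int[mu]_(t in `[- (B + 1), B + 1]) (f 0%N t * u c t))); last first.
  by apply/funext => c; exact: integral_vanish_out (v c).
have [M M0 fM] := bounded_on_segment (- (B + 1)) (B + 1) (jet_continuous jf 0%N).
apply: (@is_derive_integral R _ _ (-1) 1 (M * (`|B + 1| * 1)) (fun c t => f 0%N t * u c t)
  (fun c t => f 0%N t * (t * u' c t))).
- by rewrite oppr_lt0 ltr01.
- by move=> c; apply: continuous_mul => //; exact: jet_continuous.
- move=> c t _ tB; rewrite !normrM; apply: ler_pM => //; first exact: fM.
  apply: ler_pM => //; apply: le_trans (ler_norm _).
  by rewrite ler_norml.
Qed.

Lemma is_derive_sinint0 B f : jet f -> jet_vanish B f ->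
  is_derive (0 : R) 1 (sinint (f 0%N)) (\int[mu]_t (f 0%N t * t)).
Proof.
move=> jf fB.
have := @is_derive_trigint B f (fun c t => sin (c * t)) (fun c t => cos (c * t)) jf fB.
under [in X in _ -> _ -> _ -> X]eq_Rintegral do rewrite mul0r cos0 mulr1.
apply.
- move=> c t; have := is_derive_sin_mul t c; rewrite [t * c]mulrC.
  by congr (is_derive _ _ _ _); apply/funext => s; rewrite mulrC.
- exact: continuous_sin_mul.
- by move=> c t; exact: cos_max.
Qed.

Lemma is_derive_cosint0 B f : jet f -> jet_vanish B f ->
  is_derive (0 : R) 1 (cosint (f 0%N)) (0 : R).
Proof.
move=> jf fB.
have := @is_derive_trigint B f (fun c t => cos (c * t)) (fun c t => - sin (c * t)) jf fB.
under [in X in _ -> _ -> _ -> X]eq_Rintegral do rewrite mul0r sin0 oppr0 !mulr0.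
rewrite Rintegral_cst// mul0r; apply.
- move=> c t; have := is_derive_cos_mul t c; rewrite [t * c]mulrC mulrN.
  by congr (is_derive _ _ _ _); apply/funext => s; rewrite mulrC.
- exact: continuous_cos_mul.
- by move=> c t; rewrite normrN sin_max.
Qed.

Lemma cosintN (g : R -> R) c : cosint g (- c) = cosint g c.
Proof. by apply: eq_Rintegral => t _; rewrite mulNr cosN. Qed.

Lemma sinintN B f c : jet f -> jet_vanish B f ->
  sinint (f 0%N) (- c) = - sinint (f 0%N) c.
Proof.
move=> jf fB; rewrite -[RHS]mulN1r /sinint -RintegralZl//; last first.
  exact: (integrable_jet_mul 0 jf fB (@continuous_sin_mul c)).
by apply: eq_Rintegral => t _; rewrite mulNr sinN mulrN mulN1r.
Qed.

End OddPrimitive.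

(** * Descent by two dimensions *)

Section RadialFourier.
Context {R : realType}.
Local Notation mu := (@lebesgue_measure R).
Implicit Types (P : nat -> R -> R) (B c q w : R) (j n : nat).

(** The operator -1/(2 pi r) d/dr iterated on an even function, as a function
    of the squared radius. *)
Definition descent P j q : R := (- (1 / (2 * pi))) ^+ j * iter j jet_radial P 0 (Num.sqrt q).

Lemma profile_descent B P j : 0 <= B -> jet P -> even_jet P -> jet_vanish B P ->
  profile ((B + 1) ^+ 2) (descent P j).
Proof.
move=> B0 jP eP PB; split=> [q|q Bq].
  apply: cvgM; first exact: cvg_cst.
  apply: (@continuous_comp _ _ _ Num.sqrt (iter j jet_radial P 0%N)).
    exact: sqrt_continuous.
  by apply: jet_continuous; exact: jet_iter_radialP.
rewrite /descent (jet_vanish_iter_radial j B0 jP eP PB) ?mulr0//.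
rewrite ger0_norm ?sqrtr_ge0// (@lt_le_trans _ _ (B + 1)) ?ltrDl//.
by rewrite -(ger0_norm (addr_ge0 B0 ler01)) -sqrtr_sqr ler_sqrt// (le_trans _ Bq)// sqr_ge0.
Qed.

(** Integrating over a plane undoes one step of the descent. *)
Lemma abel_abel_descent B P j q : 0 <= B -> jet P -> even_jet P -> jet_vanish B P ->
  0 <= q -> abel (abel (descent P j.+1)) q = descent P j q.
Proof.
move=> B0 jP eP PB q0.
have pj := profile_descent j B0 jP eP PB.
have pi0 : pi != 0 :> R by rewrite gt_eqF// pi_gt0.
pose G w := - pi^-1 * descent P j w.
have cG : continuous G by move=> w; apply: cvgM; [exact: cvg_cst|exact: pj.1].
have G0 w : (B + 1) ^+ 2 <= w -> G w = 0 by move=> Bw; rewrite /G pj.2// mulr0.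
have dG w : q < w -> is_derive w 1 G (descent P j.+1 w).
  move=> qw; have w0 : 0 < w by apply: le_lt_trans qw.
  have s0 : Num.sqrt w != 0 by rewrite sqrtr_eq0 -ltNge.
  have ji := jet_iter_radialP j jP.
  have := is_derive_scale (- pi^-1) (is_derive_scale ((- (1 / (2 * pi))) ^+ j) (is_derive_comp (ji 0%N (Num.sqrt w)) (is_derive1_sqrt w0))).
  congr (is_derive _ _ _ _).
  rewrite -(jet_radialE _ ji (even_jet_iter_radial j jP eP)) /descent exprS iterS.
  by move: (pi : R) pi0 => y y0; field; rewrite s0 y0.
rewrite (abel_abel (profile_descent j.+1 B0 jP eP PB) cG dG G0).
by rewrite /G mulrA mulrNN mulfV// mul1r.
Qed.

Lemma iter_abel_ext n (H1 H2 : R -> R) : (forall q, 0 <= q -> H1 q = H2 q) ->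
  forall q, 0 <= q -> iter n abel H1 q = iter n abel H2 q.
Proof. by elim: n => //= n IHn H12; apply: abel_ext; exact: IHn. Qed.

Lemma iter_abel_descent B P j q : 0 <= B -> jet P -> even_jet P -> jet_vanish B P ->
  0 <= q -> iter j.*2 abel (descent P j) q = P 0%N (Num.sqrt q).
Proof.
move=> B0 jP eP PB; elim: j q => [|j IHj] q q0.
  by rewrite /= /descent expr0 mul1r.
rewrite doubleS !iterSr -IHj//; apply: iter_abel_ext => // w w0.
exact: abel_abel_descent B0 jP eP PB w0.
Qed.

(** Integrating out the 2p + 2 coordinates orthogonal to xi undoes the p + 1
    steps of the descent and leaves the profiles P and P' themselves. *)
Lemma real_integral_descent B P P' p (a b : R) (xi : 'rV[R]_p.*2.+3) :
  0 <= B -> jet P -> even_jet P -> jet_vanish B P ->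
  jet P' -> even_jet P' -> jet_vanish B P' ->
  real_integral (fun x => descent P p.+1 (dotp x x) * (a * cos (- (2 * pi * dotp xi x))) +
     descent P' p.+1 (dotp x x) * (b * sin (- (2 * pi * dotp xi x)))) =
  a * cosint (P 0%N) (2 * pi * enorm xi) - b * sinint (P' 0%N) (2 * pi * enorm xi).
Proof.
move=> B0 jP eP PB jP' eP' PB'.
pose E1 (u : R) := a * cos (- (2 * pi) * u); pose E2 (u : R) := b * sin (- (2 * pi) * u).
have cE1 : continuous E1.
  by apply: continuous_mul; [exact: cst_continuous|exact: continuous_cos_mul].
have cE2 : continuous E2.
  by apply: continuous_mul; [exact: cst_continuous|exact: continuous_sin_mul].
transitivity (real_integral (fun x => wave (descent P p.+1) E1 (descent P' p.+1) E2 (0 + dotp x x) (dotp xi x))).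
  by congr real_integral; apply/funext => x; rewrite add0r /wave /E1 /E2 !mulNr.
rewrite (real_integral_wave _ _ (profile_descent _ B0 jP eP PB) (profile_descent _ B0 jP' eP' PB') cE1 cE2).
have val Q t : jet Q -> even_jet Q -> jet_vanish B Q ->
    iter p.*2.+2 abel (descent Q p.+1) (0 + t ^+ 2) = Q 0%N t.
  move=> jQ eQ QB; rewrite -doubleS add0r (iter_abel_descent p.+1 B0 jQ eQ QB) ?sqr_ge0// sqrtr_sqr.
  by have [t0|t0] := leP 0 t; [rewrite ger0_norm|rewrite ltr0_norm].
pose c := 2 * pi * enorm xi.
transitivity (\int[mu]_t (P 0%N t * (a * cos (c * t)) - P' 0%N t * (b * sin (c * t)))).
  apply: eq_Rintegral => t _; rewrite /wave !val// /E1 /E2.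
  have -> : - (2 * pi) * (enorm xi * t) = - (c * t) by rewrite /c; ring.
  by rewrite cosN sinN !mulrN.
have ci := integrable_jet_mul 0 jP PB (@continuous_cos_mul R c).
have si := integrable_jet_mul 0 jP' PB' (@continuous_sin_mul R c).
rewrite RintegralB//; last 2 first.
- apply: (integrable_jet_mul 0 jP PB); apply: continuous_mul; [exact: cst_continuous|exact: continuous_cos_mul].
- apply: (integrable_jet_mul 0 jP' PB'); apply: continuous_mul; [exact: cst_continuous|exact: continuous_sin_mul].
rewrite /cosint /sinint -!RintegralZl//.
by congr (_ - _); apply: eq_Rintegral => t _; rewrite mulrCA.
Qed.

Lemma line_fourierE B (phi : 'rV[R]_1 -> R[i]) (r : R) :
  jet (re_jet phi) -> jet (im_jet phi) ->
  jet_vanish B (re_jet phi) -> jet_vanish B (im_jet phi) ->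
  fourier phi (const_mx r) =
  (cosint (re_jet phi 0%N) (2 * pi * r) + sinint (im_jet phi 0%N) (2 * pi * r)) +i*
  (cosint (im_jet phi 0%N) (2 * pi * r) - sinint (re_jet phi 0%N) (2 * pi * r)).
Proof.
move=> j1 j2 v1 v2; set c := 2 * pi * r.
have dE (t : R) (y : 'rV[R]_0) : row_mx (const_mx t : 'rV[R]_1) y = const_mx t.
  apply/rowP => i; rewrite !mxE; case: splitP => j _; rewrite ?mxE//.
  by case: j.
have dotE (t : R) : 2 * pi * dotp (const_mx r : 'rV[R]_1) (const_mx t) = c * t.
  by rewrite /dotp big_ord1 !mxE mulrA.
have ic f : jet f -> jet_vanish B f -> mu.-integrable setT (EFin \o (fun t => f 0%N t * cos (c * t))).
  by move=> jf fB; exact: (integrable_jet_mul 0 jf fB (@continuous_cos_mul R c)).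
have is_ f : jet f -> jet_vanish B f -> mu.-integrable setT (EFin \o (fun t => f 0%N t * sin (c * t))).
  by move=> jf fB; exact: (integrable_jet_mul 0 jf fB (@continuous_sin_mul R c)).
rewrite /fourier /cintegral; congr (_ +i* _).
- rewrite /cosint /sinint -RintegralD//; [|exact: ic|exact: is_].
  apply: eq_Rintegral => t _ /=; rewrite /re_part dE dotE /expi cosN sinN.
  rewrite /re_jet /im_jet /line_jet /pderiv /= /re_part /im_part.
  by case: (phi _) => u v /=; rewrite mulrN opprK.
- rewrite /cosint /sinint -RintegralB//; [|exact: ic|exact: is_].
  apply: eq_Rintegral => t _ /=; rewrite /im_part dE dotE /expi cosN sinN.
  rewrite /re_jet /im_jet /line_jet /pderiv /= /re_part /im_part.
  by case: (phi _) => u v /=; rewrite mulrN addrC.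
Qed.

End RadialFourier.

(** * The Fourier transform of the spectral lift *)

Section FourierOfLift.
Context {R : realType}.
Local Notation mu := (@lebesgue_measure R).
Variables (p : nat) (B : R) (phi : 'rV[R]_1 -> R[i]).
Hypotheses (B0 : 0 <= B) (sphi : smooth phi).
Hypotheses (reB : jet_vanish B (re_jet phi)) (imB : jet_vanish B (im_jet phi)).

Let jre : jet (re_jet phi). Proof. exact: line_jetP sphi.1. Qed.
Let jim : jet (im_jet phi). Proof. exact: line_jetP sphi.2. Qed.

(** The quotient of f(r) - f(-r) by r is P'(r)/r for a primitive P, so the p
    steps of the spectral lift become p + 1 steps applied to P. *)
Lemma spectral_lift_descent (P1 P2 : nat -> R -> R) (x : 'rV[R]_p.*2.+3) :
  jet_shift P1 = jet_odd (re_jet phi) -> jet_shift P2 = jet_odd (im_jet phi) ->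
  spectral_lift phi x = (- (2 * pi) * descent P2 p.+1 (dotp x x)) +i*
                        (2 * pi * descent P1 p.+1 (dotp x x)).
Proof.
move=> s1 s2; rewrite (spectral_liftE (erefl : p.*2.+3 = p.*2.+3) x sphi).
have pi0 : pi != 0 :> R by rewrite gt_eqF// pi_gt0.
have c1 : (- (1 / (2 * pi))) ^+ p.+1 * - (2 * pi) = spectral_const p :> R.
  rewrite exprSr -mulrA /spectral_const.
  by move: (pi : R) pi0 => y y0; rewrite mulrNN mul1r mulVf ?mulr1// mulf_neq0.
have dE P f : jet_shift P = jet_odd f -> descent P p.+1 (dotp x x) =
    (- (1 / (2 * pi))) ^+ p.+1 * radial (iter p jet_radial (jet_quot (jet_odd f))) x.
  move=> s; rewrite /descent /radial; congr (_ * _).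
  by rewrite iterSr; congr (iter p jet_radial _ 0%N _); rewrite /jet_radial s.
have H a1 a2 : (spectral_const p * a2) +i* (- (spectral_const p * a1)) =
    (- (2 * pi) * ((- (1 / (2 * pi))) ^+ p.+1 * a2)) +i*
    (2 * pi * ((- (1 / (2 * pi))) ^+ p.+1 * a1)) :> R[i].
  by rewrite -c1; congr (_ +i* _); ring.
rewrite (dE _ _ s1) (dE _ _ s2); exact: H.
Qed.

Let is_derive_twopi (u : R -> R) (l : R) : is_derive (0 : R) 1 u l ->
  is_derive (0 : R) 1 (fun h => u (2 * pi * h)) (2 * pi * l).
Proof.
move=> du; have := @is_derive_comp_affine R u 0 (2 * pi) 0 l.
rewrite mulr0 addr0 => /(_ du); congr (is_derive _ _ _ _).
by apply/funext => h; rewrite addr0.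
Qed.

(** The derivative of the Fourier transform at the origin is a first moment. *)
Lemma ddelta_line_fourier :
  ddelta 1 0 (fourier phi) =
  (- (2 * pi * \int[mu]_t (im_jet phi 0 t * t))) +i* (2 * pi * \int[mu]_t (re_jet phi 0 t * t)).
Proof.
have lineE h : h *: (delta_mx 0 ord0 : 'rV[R]_1) + const_mx 0 = const_mx h.
  by apply/rowP => i; rewrite !mxE ord1 !eqxx mulr1 addr0.
have dre : is_derive (const_mx 0 : 'rV[R]_1) (delta_mx 0 ord0) (re_part (fourier phi))
    (2 * pi * 0 + 2 * pi * \int[mu]_t (im_jet phi 0 t * t)).
  apply: is_derive_line.
  have := is_derive_add (is_derive_twopi (is_derive_cosint0 jre reB)) (is_derive_twopi (is_derive_sinint0 jim imB)).
  congr (is_derive _ _ _ _); apply/funext => h.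
  by rewrite /re_part lineE (line_fourierE h jre jim reB imB).
have dim : is_derive (const_mx 0 : 'rV[R]_1) (delta_mx 0 ord0) (im_part (fourier phi))
    (2 * pi * 0 + - (2 * pi * \int[mu]_t (re_jet phi 0 t * t))).
  apply: is_derive_line.
  have := is_derive_add (is_derive_twopi (is_derive_cosint0 jim imB)) (is_derive_opp (is_derive_twopi (is_derive_sinint0 jre reB))).
  congr (is_derive _ _ _ _); apply/funext => h.
  by rewrite /im_part lineE (line_fourierE h jre jim reB imB).
rewrite ddeltaE expr1 /re_jet /im_jet /line_jet /=; case: dre => _ ->; case: dim => _ ->.
by rewrite mulr0 !add0r !mulN1r opprK.
Qed.

(** Both sides reduce to sine transforms of phi divided by the norm of xi: the
    left side by descending to the cosine transform of the primitives P1 and P2, the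
    right side because the cosine terms cancel in the odd part. At xi = 0 the
    quotients become first moments. The sine transforms of P1 and P2 drop out
    by parity. *)
Lemma fourier_spectral_lift (xi : 'rV[R]_p.*2.+3) :
  fourier (spectral_lift phi) xi = odd_lift (fourier phi) xi.
Proof.
have pi0 : pi != 0 :> R by rewrite gt_eqF// pi_gt0.
have [P1 [jP1 eP1 PB1 s1]] := odd_primitive B0 jre reB.
have [P2 [jP2 eP2 PB2 s2]] := odd_primitive B0 jim imB.
pose c := 2 * pi * enorm xi.
have -> : fourier (spectral_lift phi) xi =
    (- (2 * pi) * cosint (P2 0%N) c) +i* (2 * pi * cosint (P1 0%N) c).
  rewrite /fourier /cintegral; congr (_ +i* _).
    transitivity (- (2 * pi) * cosint (P2 0%N) c - - (2 * pi) * sinint (P1 0%N) c); last first.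
      by rewrite (sinint_even _ jP1 PB1 eP1) mulr0 subr0.
    rewrite -(real_integral_descent (- (2 * pi)) (- (2 * pi)) xi B0 jP2 eP2 PB2 jP1 eP1 PB1).
    congr real_integral; apply/funext => x.
    by rewrite /re_part (spectral_lift_descent x s1 s2) /expi /=; ring.
  transitivity (2 * pi * cosint (P1 0%N) c - - (2 * pi) * sinint (P2 0%N) c); last first.
    by rewrite (sinint_even _ jP2 PB2 eP2) mulr0 subr0.
  rewrite -(real_integral_descent (2 * pi) (- (2 * pi)) xi B0 jP1 eP1 PB1 jP2 eP2 PB2).
  congr real_integral; apply/funext => x.
  by rewrite /im_part (spectral_lift_descent x s1 s2) /expi /=; ring.
rewrite /odd_lift; case: eqVneq => [xi0|xiN0].
  have -> : c = 0 by rewrite /c xi0 enorm0 mulr0.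
  rewrite (cosint_primitive0 B0 jre reB jP1 PB1 s1) (cosint_primitive0 B0 jim imB jP2 PB2 s2).
  rewrite ddelta_line_fourier (_ : - 2 = (- 2 : R)%:C); last by rewrite rmorphN rmorph_nat.
  by rewrite mul_real_complex; congr (_ +i* _); ring.
have r0 : enorm xi != 0 by rewrite enorm_eq0.
have c0 : c != 0 by rewrite !mulf_neq0.
have e2 := cosint_primitive c B0 jim imB jP2 PB2 s2.
have e1 := cosint_primitive c B0 jre reB jP1 PB1 s1.
have -> : cosint (P2 0%N) c = - 2 * sinint (im_jet phi 0%N) c / c by rewrite -e2 mulrC mulKf.
have -> : cosint (P1 0%N) c = - 2 * sinint (re_jet phi 0%N) c / c by rewrite -e1 mulrC mulKf.
have dd t : ddelta 0 t (fourier phi) = fourier phi (const_mx t).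
  by rewrite /ddelta expr0 mul1r /cpderiv/= /re_part /im_part; case: (fourier _ _).
rewrite !dd !(line_fourierE _ jre jim reB imB) mulrN -/c.
rewrite !cosintN (sinintN _ jre reB) (sinintN _ jim imB) [RHS]mulrC -real_complexV.
rewrite opp_complexE add_complexE mul_real_complex; congr (_ +i* _).
  rewrite /c; move: (pi : R) pi0 (sinint _ _) (cosint _ _) => y y0 u v.
  by field; rewrite y0 r0.
rewrite /c; move: (pi : R) pi0 (sinint _ _) (cosint _ _) => y y0 u v.
by field; rewrite y0 r0.
Qed.

End FourierOfLift.

(** * Linear combinations of smooth functions *)

Section SmoothLinear.
Context {R : realType} {n : nat}.
Implicit Types (f g : 'rV[R]_n -> R) (phi psi : 'rV[R]_n -> R[i]).

Lemma pderiv_linear (a : R) f g l : real_smooth f -> real_smooth g ->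
  pderiv l (fun x => a * f x + g x) = (fun x => a * pderiv l f x + pderiv l g x).
Proof.
move=> sf sg; elim: l => //= i l ->; apply/funext => x.
have df := derivableP ((sf l).2 i x); have dg := derivableP ((sg l).2 i x).
by have [_ <-] := is_deriveD (is_deriveZ a df) dg.
Qed.

Lemma real_smooth_linear (a : R) f g : real_smooth f -> real_smooth g ->
  real_smooth (fun x => a * f x + g x).
Proof.
move=> sf sg l; rewrite pderiv_linear//; split.
  by move=> x; exact: (cvgD (cvgM (cvg_cst a) ((sf l).1 x)) ((sg l).1 x)).
move=> i x; have df := derivableP ((sf l).2 i x); have dg := derivableP ((sg l).2 i x).
by have [] := is_deriveD (is_deriveZ a df) dg.
Qed.

Let reE (c : R[i]) phi psi : re_part (fun x => c * phi x + psi x) =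
  (fun x => complex.Re c * re_part phi x + (- complex.Im c * im_part phi x + re_part psi x)).
Proof.
apply/funext => x; rewrite /re_part /im_part.
by case: c => a b; case: (phi x) => u v; case: (psi x) => u' v' /=; ring.
Qed.

Let imE (c : R[i]) phi psi : im_part (fun x => c * phi x + psi x) =
  (fun x => complex.Re c * im_part phi x + (complex.Im c * re_part phi x + im_part psi x)).
Proof.
apply/funext => x; rewrite /re_part /im_part.
by case: c => a b; case: (phi x) => u v; case: (psi x) => u' v' /=; ring.
Qed.

Lemma smooth_linear c phi psi : smooth phi -> smooth psi ->
  smooth (fun x => c * phi x + psi x).
Proof.
by move=> [f1 f2] [g1 g2]; split; rewrite ?reE ?imE; do 2 apply: real_smooth_linear => //.
Qed.

Lemma cpderiv_linear c phi psi l x : smooth phi -> smooth psi ->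
  cpderiv l (fun x => c * phi x + psi x) x = c * cpderiv l phi x + cpderiv l psi x.
Proof.
move=> [f1 f2] [g1 g2].
rewrite /cpderiv reE imE !pderiv_linear//; try exact: real_smooth_linear.
by case: c => a b; congr (_ +i* _); rewrite /=; ring.
Qed.

Lemma fsupp_linear c phi psi :
  fsupp (fun x => c * phi x + psi x) `<=` fsupp phi `|` fsupp psi.
Proof.
have cl : closed (fsupp phi `|` fsupp psi).
  by apply: closedU; exact: closed_closure.
move=> x xs; apply: cl; apply: closure_subset x xs => x /= xN0.
have [px|px] := eqVneq (phi x) 0; last by left; apply: subset_closure.
have [qx|qx] := eqVneq (psi x) 0; last by right; apply: subset_closure.
by rewrite px qx mulr0 addr0 eqxx in xN0.
Qed.

Lemma test_function_linear c phi psi : test_function phi -> test_function psi ->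
  test_function (fun x => c * phi x + psi x).
Proof.
move=> [sf cf] [sg cg]; split; first exact: smooth_linear.
apply: subclosed_compact (compactU cf cg) (@fsupp_linear c phi psi).
exact: closed_closure.
Qed.

End SmoothLinear.

(** * Locally finite sums *)

Section LocallyFinite.
Context {R : realType} {n : nat}.

(** Every point has a neighbourhood that meets A at most in that point, and
    finitely many of them cover K. *)
Lemma locally_finite_compact (A K : set 'rV[R]_n) :
  locally_finite A -> compact K -> finite_set (A `&` K).
Proof.
move=> lfA; rewrite compact_cover => cK.
have /choice[U Uopen] : forall x : 'rV[R]_n, exists U : set 'rV[R]_n, [/\ open U, U x & A `&` U `<=` [set x]].
  move=> x; have : ~ limit_point A x by rewrite lfA.
  rewrite not_limit_pointE => -[X xX AX].
  exists X^°; split; [exact: open_interior|exact: xX|].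
  by move=> y [Ay /interior_subset Xy]; apply: AX.
have [|D _ KD] := cK _ setT U (fun x _ => let: And3 o _ _ := Uopen x in o).
  by move=> x _; exists x => //; have [] := Uopen x.
apply: sub_finite_set (finite_fset D).
by move=> x [Ax /KD[y yD Uyx]]; have [_ _ /(_ x (conj Ax Uyx)) ->] := Uopen y.
Qed.

(** A sum of infinitely many nonzero terms is 0 by convention, so splitting off
    a term needs the finiteness that K provides. *)
Lemma fsum_split0 (A K : set 'rV[R]_n) (F : 'rV[R]_n -> R[i]) :
  locally_finite A -> compact K -> (forall x, ~ K x -> F x = 0) ->
  (~ A 0 -> F 0 = 0) ->
  \sum_(x \in A) F x = F 0 + \sum_(x \in A `\ 0) F x.
Proof.
move=> lfA cK FK F0; have fAK := locally_finite_compact lfA cK.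
have [A0|A0] := pselect (A 0); last first.
  rewrite F0// add0r; apply: eq_fsbigl; apply/seteqP; split=> x; last by case.
  by move=> Ax; split=> // x0; apply: A0; rewrite -x0.
have wide (D : set 'rV[R]_n) : D `<=` A -> \sum_(x \in D) F x = \sum_(x \in D `&` K) F x.
  move=> DA; apply/esym/fsbig_widen; first exact: subIsetl.
  by move=> x [Dx DKx]; apply: FK => Kx; apply: DKx.
have [K0|K0] := pselect (K 0); last first.
  rewrite FK// add0r; rewrite [RHS]wide; last exact: subDsetl.
  rewrite wide//; apply: eq_fsbigl; apply/seteqP; split=> x.
    by move=> [Ax Kx]; split=> //; split=> // x0; apply: K0; rewrite -x0.
  by move=> [[Ax _] Kx].
rewrite [LHS]wide// (fsbigD1 0)//; congr (_ + _).
rewrite [RHS]wide; last exact: subDsetl.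
by apply: eq_fsbigl; apply/seteqP; split=> x [[? ?] ?].
Qed.

End LocallyFinite.

Section EuclideanBalls.
Context {R : realType} {k : nat}.

Lemma closed_enorm_ball (B : R) : closed [set x : 'rV[R]_k | enorm x <= B].
Proof.
have -> : [set x : 'rV[R]_k | enorm x <= B] = (@enorm R k) @^-1` [set r | r <= B] by [].
by apply: closed_comp; [move=> x _; exact: continuous_enorm|exact: closed_le].
Qed.

Lemma compact_enorm_ball (B : R) : compact [set x : 'rV[R]_k | enorm x <= B].
Proof.
have c := @rV_compact R k (fun=> `[(- B), B]%classic) (fun=> @segment_compact R _ _).
apply: subclosed_compact (@closed_enorm_ball B) c _ => x /= xB i.
by rewrite in_itv/= -ler_norml (le_trans (coord_le_enorm x i)).
Qed.

End EuclideanBalls.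

(** * Seminorm estimates on the line *)

Section LineFunctions.
Context {R : realType}.
Implicit Types (phi psi : 'rV[R]_1 -> R[i]) (f : nat -> R -> R) (B M c : R).

(** The bound depends on K only, as continuity on test functions requires. *)
Lemma line_support (K : set 'rV[R]_1) : compact K ->
  exists2 B, 0 <= B & forall phi, smooth phi -> fsupp phi `<=` K ->
    jet_vanish B (re_jet phi) /\ jet_vanish B (im_jet phi).
Proof.
move=> cK.
have cc : {within K, continuous (fun x : 'rV[R]_1 => x 0 0)}.
  by apply: continuous_subspaceT; exact: coord_continuous.
have [M [_ KM]] := compact_bounded (continuous_compact cc cK).
have M1 : M < `|M| + 1 by rewrite (le_lt_trans (ler_norm M))// ltrDl.
exists (`|M| + 1) => [|phi sphi pK]; first by rewrite addr_ge0.
have phi0 t : `|M| + 1 < `|t| -> phi (const_mx t) = 0.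
  move=> Mt; apply/eqP/negPn/negP => pN0.
  have Kt : K (const_mx t) by apply: pK; apply: subset_closure.
  have := KM _ M1 t; rewrite /= leNgt Mt => /(_ _)/negP; apply=> //.
  by exists (const_mx t) => //; rewrite mxE.
split; apply: jet_vanishP => [|t Bt]; try exact: line_jetP sphi.1; try exact: line_jetP sphi.2.
- by rewrite /re_jet /line_jet /= /re_part phi0.
- by rewrite /im_jet /line_jet /= /im_part phi0.
Qed.

Lemma test_line_support phi : test_function phi -> exists2 B, 0 <= B &
  jet_vanish B (re_jet phi) /\ jet_vanish B (im_jet phi).
Proof.
by move=> [sphi cphi]; have [B B0 HB] := line_support cphi; exists B => //; exact: HB.
Qed.

(** On the support the weight is at most its value at B. *)
Lemma jet_bound_vanish N n f B M : 0 <= B -> jet_vanish B f ->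
  (forall j x, (j <= n)%N -> `|f j x| <= M) -> jet_bound N n f ((1 + B) ^+ N * M).
Proof.
move=> B0 fB fM j x jn; have [xB|Bx] := leP `|x| B; last first.
  rewrite fB// normr0 mulr0 mulr_ge0// ?exprn_ge0// ?addr_ge0//.
  by apply: le_trans (fM 0%N 0 (leq0n n)).
have lX : (1 + `|x|) ^+ N <= (1 + B) ^+ N by rewrite lerXn2r ?nnegrE ?addr_ge0// lerD2l.
have lX0 : 0 <= (1 + `|x|) ^+ N by rewrite exprn_ge0// addr_ge0.
exact: (ler_pM lX0 (normr_ge0 _) lX (fM j x jn)).
Qed.

Lemma vanish_schwartz_jet B f : 0 <= B -> jet f -> jet_vanish B f -> schwartz_jet f.
Proof.
move=> B0 jf fB; split=> // N n.
suff [M fM] : exists M, forall j x, (j <= n)%N -> `|f j x| <= M.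
  by exists ((1 + B) ^+ N * M); exact: jet_bound_vanish.
elim: n => [|n [M fM]].
  have [M M0 fM] := bounded_on_segment (- B) B (jet_continuous jf 0%N).
  exists M => j x; rewrite leqn0 => /eqP ->; have [xB|Bx] := leP `|x| B.
    by apply: fM; rewrite -ler_norml.
  by rewrite fB// normr0.
have [M' M'0 fM'] := bounded_on_segment (- B) B (jet_continuous jf n.+1).
have M0 : 0 <= M by apply: le_trans (fM 0%N 0 (leq0n n)).
exists (M + M') => j x; rewrite leq_eqVlt => /predU1P[->|jn]; last first.
  by apply: le_trans (fM j x jn) _; rewrite lerDl.
have [xB|Bx] := leP `|x| B; last by rewrite fB// normr0 addr_ge0.
by apply: (@le_trans _ _ M'); [apply: fM'; rewrite -ler_norml|rewrite lerDr].
Qed.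

Lemma jets_schwartz_bound N phi M1 M2 : jet_bound N N (re_jet phi) M1 ->
  jet_bound N N (im_jet phi) M2 -> schwartz_bound N phi (M1 + M2).
Proof.
move=> b1 b2 l x lN; rewrite -(const_mx_coord x) enorm_const.
apply: le_trans (_ : (1 + `|x 0 0|) ^+ N * (`|re_jet phi (size l) (x 0 0)| + `|im_jet phi (size l) (x 0 0)|) <= _).
  rewrite ler_wpM2l ?exprn_ge0 ?addr_ge0//; apply: le_trans (cmod_le _) _.
  by rewrite /cpderiv/= !pderiv_line !mxE.
by rewrite mulrDr lerD// ?b1 ?b2.
Qed.

Lemma test_schwartz phi : test_function phi -> schwartz phi.
Proof.
move=> tphi; have [B B0 [v1 v2]] := test_line_support tphi; have [s1 s2] := tphi.1.
split=> [|N]; first exact: tphi.1.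
have [_ /(_ N N)[c1 b1]] := vanish_schwartz_jet B0 (line_jetP s1) v1.
have [_ /(_ N N)[c2 b2]] := vanish_schwartz_jet B0 (line_jetP s2) v2.
by exists (c1 + c2); exact: jets_schwartz_bound.
Qed.

Lemma test_bound_jets N N' B phi M : 0 <= B -> jet_vanish B (re_jet phi) ->
  jet_vanish B (im_jet phi) -> test_bound N phi M ->
  jet_bound N' N (re_jet phi) ((1 + B) ^+ N' * M) /\
  jet_bound N' N (im_jet phi) ((1 + B) ^+ N' * M).
Proof.
move=> B0 v1 v2 pM; split; apply: jet_bound_vanish => // j x jN.
- apply: le_trans (normr_Re_cmod (cpderiv (nseq j ord0) phi (const_mx x))) _.
  by apply: pM; rewrite size_nseq.
- apply: le_trans (normr_Im_cmod (cpderiv (nseq j ord0) phi (const_mx x))) _.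
  by apply: pM; rewrite size_nseq.
Qed.

(** Among functions supported in a fixed compact set the Schwartz seminorms are
    bounded by multiples of the sup norms of derivatives. *)
Lemma temperate_extension_distribution (u T : ('rV[R]_1 -> R[i]) -> R[i]) :
  temperate_extension u T -> Defs.distribution u.
Proof.
move=> [[Tlin [N [C TC]]] Tu]; split.
  move=> c phi psi tphi tpsi; rewrite -!Tu//; last exact: test_function_linear.
  by apply: Tlin; exact: test_schwartz.
move=> K cK; have [B B0 HB] := line_support cK.
exists N, (C * (2 * (1 + B) ^+ N)) => phi M tphi pK pM.
have [v1 v2] := HB phi tphi.1 pK.
have [b1 b2] := test_bound_jets N B0 v1 v2 pM.
rewrite -Tu// -!mulrA mulr_natl mulr2n; apply: TC; first exact: test_schwartz.
exact: jets_schwartz_bound.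
Qed.

End LineFunctions.

(** * Continuity of the lifts *)

Section LiftJets.
Context {R : realType}.
Implicit Types (f : nat -> R -> R) (B c a : R) (p N n : nat).

(** The common shape of the two lifts: p = 0 for odd_lift, and a general p for
    spectral_lift. *)
Definition lift_jet p a f := jet_scale a (iter p jet_radial (jet_quot (jet_odd f))).

Lemma lift_jetP p a f : jet f -> jet (lift_jet p a f).
Proof. by move=> jf; apply/jet_scaleP/jet_iter_radialP/jet_quotP/jet_oddP. Qed.

Lemma even_lift_jet p a f : jet f -> even_jet (lift_jet p a f).
Proof.
move=> jf x; rewrite /lift_jet /jet_scale even_jet_iter_radial//.
  exact/jet_quotP/jet_oddP.
exact: even_jet_quot_odd.
Qed.

Lemma lift_jet_vanish p a f B : 0 <= B -> jet f -> jet_vanish B f ->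
  jet_vanish B (lift_jet p a f).
Proof.
move=> B0 jf fB; have jq := jet_quotP (jet_oddP jf).
have qB : jet_vanish B (jet_quot (jet_odd f)).
  apply: jet_vanishP => // t Bt; have t0 : t != 0.
    by apply/eqP => t0; rewrite t0 normr0 ltNge B0 in Bt.
  by rewrite jet_quot_oddE// !fB ?normrN// subrr mul0r.
move=> n t Bt; rewrite /lift_jet /jet_scale.
by rewrite (jet_vanish_iter_radial p B0 jq (even_jet_quot_odd jf) qB)// mulr0.
Qed.

Lemma lift_jet_bound p a N n : exists2 C, 0 <= C & forall f c, jet f ->
  jet_bound N (p.*2 + n).+1 f c -> jet_bound N n (lift_jet p a f) (C * c).
Proof.
have [C C0 HC] := @jet_bound_iter_radial R p N n.
have [D D0 HD] := @jet_bound_quot R N (p.*2 + n).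
exists (`|a| * (C * (D * 2))) => [|f c jf fc]; first by rewrite !mulr_ge0.
rewrite -!mulrA; apply: jet_bound_scale; apply: HC.
- exact/jet_quotP/jet_oddP.
- exact: even_jet_quot_odd.
- apply: HD; [exact: jet_oddP|exact: jet_odd_at0|exact: jet_bound_odd].
Qed.

Lemma schwartz_lift_jet p a f : schwartz_jet f -> schwartz_jet (lift_jet p a f).
Proof.
move=> [jf fb]; split=> [|N n]; first exact: lift_jetP.
have [C C0 HC] := lift_jet_bound p a N n.
by have [c fc] := fb N (p.*2 + n).+1; exists (C * c); exact: HC.
Qed.

End LiftJets.

Section RadialPairs.
Context {R : realType} {k : nat}.
Implicit Types (psi : 'rV[R]_k -> R[i]) (f g : nat -> R -> R).

Definition radial_pair f g (x : 'rV[R]_k) : R[i] := (radial f x) +i* (radial g x).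

Lemma radial_pair_bound N : exists2 C : R, 0 <= C & forall f g c, jet f -> even_jet f ->
  jet g -> even_jet g -> jet_bound N.*2 N.*2 f c -> jet_bound N.*2 N.*2 g c ->
  schwartz_bound N (radial_pair f g) (C * c).
Proof.
have [C C0 HC] := @radial_bound R k N; exists (C * 2) => [|f g c jf ef jg eg fc gc l x lN].
  by rewrite mulr_ge0.
apply: le_trans (_ : (1 + enorm x) ^+ N * (`|pderiv l (radial f) x| + `|pderiv l (radial g) x|) <= _).
  by rewrite ler_wpM2l ?exprn_ge0 ?addr_ge0 ?enorm_ge0//; exact: cmod_le.
by rewrite mulrDr -mulrA mulr_natl mulr2n mulrDr lerD//; exact: HC.
Qed.

Lemma smooth_radial_pair f g : schwartz_jet f -> even_jet f ->
  schwartz_jet g -> even_jet g -> smooth (radial_pair f g).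
Proof. by move=> sf ef sg eg; split; exact: real_smooth_radial. Qed.

Lemma schwartz_radial_pair f g : schwartz_jet f -> even_jet f ->
  schwartz_jet g -> even_jet g -> schwartz (radial_pair f g).
Proof.
move=> sf ef sg eg; split=> [|N]; first exact: smooth_radial_pair.
have [C C0 HC] := radial_pair_bound N.
have [c1 b1] := sf.2 N.*2 N.*2; have [c2 b2] := sg.2 N.*2 N.*2.
have [jf _] := sf; have [jg _] := sg.
exists (C * (c1 + c2)); apply: HC => //.
- by move=> j x jn; apply: le_trans (b1 j x jn) _; rewrite lerDl (jet_bound_ge0 b2).
- by move=> j x jn; apply: le_trans (b2 j x jn) _; rewrite lerDr (jet_bound_ge0 b1).
Qed.

Lemma radial_pair_out f g (B : R) x : jet_vanish B f -> jet_vanish B g -> B < enorm x ->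
  radial_pair f g x = 0.
Proof.
by move=> fB gB Bx; rewrite /radial_pair /radial fB ?gB// ger0_norm ?enorm_ge0.
Qed.

Lemma fsupp_radial_pair f g (B : R) : jet_vanish B f -> jet_vanish B g ->
  fsupp (radial_pair f g) `<=` [set x | enorm x <= B].
Proof.
move=> fB gB x xs; apply: (@closed_enorm_ball R k B); apply: closure_subset x xs => x /=.
by apply: contraNT => Bx; rewrite (radial_pair_out fB gB)// ltNge.
Qed.

Lemma schwartz_test_bound N psi (M : R) : schwartz_bound N psi M -> test_bound N psi M.
Proof.
move=> pM l x lN; apply: le_trans (pM l x lN).
rewrite ler_peMl ?sqrtr_ge0//; rewrite exprn_ege1// lerDl enorm_ge0//.
Qed.

End RadialPairs.

Section PairLift.
Context {R : realType} {k : nat}.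
Implicit Types (f g : nat -> R -> R) (B a b c : R) (p N : nat).

Definition pair_lift p a b f g : 'rV[R]_k -> R[i] :=
  radial_pair (lift_jet p a f) (lift_jet p b g).

Lemma schwartz_pair_lift p a b f g : schwartz_jet f -> schwartz_jet g ->
  schwartz (pair_lift p a b f g).
Proof.
move=> sf sg; apply: schwartz_radial_pair; first exact: schwartz_lift_jet.
- by apply: even_lift_jet; case: sf.
- exact: schwartz_lift_jet.
- by apply: even_lift_jet; case: sg.
Qed.

Lemma pair_lift_bound p a b N : exists2 C : R, 0 <= C & forall f g c, jet f -> jet g ->
  jet_bound N.*2 (p.*2 + N.*2).+1 f c -> jet_bound N.*2 (p.*2 + N.*2).+1 g c ->
  schwartz_bound N (pair_lift p a b f g) (C * c).
Proof.
have [C1 C10 H1] := @lift_jet_bound R p a N.*2 N.*2.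
have [C2 C20 H2] := @lift_jet_bound R p b N.*2 N.*2.
have [C C0 HC] := @radial_pair_bound R k N.
exists (C * (C1 + C2)) => [|f g c jf jg fc gc]; first by rewrite mulr_ge0// addr_ge0.
have c0 := jet_bound_ge0 fc.
have b1 := H1 f c jf fc; have b2 := H2 g c jg gc.
have b1' : jet_bound N.*2 N.*2 (lift_jet p a f) ((C1 + C2) * c).
  move=> j x jn; apply: le_trans (b1 j x jn) _.
  by apply: ler_wpM2r => //; rewrite lerDl.
have b2' : jet_bound N.*2 N.*2 (lift_jet p b g) ((C1 + C2) * c).
  move=> j x jn; apply: le_trans (b2 j x jn) _.
  by apply: ler_wpM2r => //; rewrite lerDr.
rewrite -mulrA; apply: (HC _ _ _ _ _ _ _ b1' b2').
- exact: lift_jetP.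
- exact: even_lift_jet.
- exact: lift_jetP.
- exact: even_lift_jet.
Qed.

Lemma pair_lift_out p a b f g B x : 0 <= B -> jet f -> jet g -> jet_vanish B f ->
  jet_vanish B g -> B < enorm x -> pair_lift p a b f g x = 0.
Proof. by move=> B0 jf jg fB gB; apply: radial_pair_out; exact: lift_jet_vanish. Qed.

Lemma test_pair_lift p a b f g B : 0 <= B -> jet f -> jet g -> jet_vanish B f ->
  jet_vanish B g -> test_function (pair_lift p a b f g) /\
  fsupp (pair_lift p a b f g) `<=` [set x | enorm x <= B].
Proof.
move=> B0 jf jg fB gB.
have supp : fsupp (pair_lift p a b f g) `<=` [set x | enorm x <= B].
  by apply: fsupp_radial_pair; exact: lift_jet_vanish.
split=> //; split.
  by apply: (schwartz_pair_lift _ _ _ (vanish_schwartz_jet B0 jf fB) (vanish_schwartz_jet B0 jg gB)).1.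
by apply: subclosed_compact (@compact_enorm_ball R k B) supp; exact: closed_closure.
Qed.

End PairLift.

Section LiftsAsPairs.
Context {R : realType} {k : nat}.
Implicit Types (phi psi : 'rV[R]_1 -> R[i]) (x : 'rV[R]_k).

Lemma odd_lift_pair phi : smooth phi ->
  odd_lift phi = pair_lift (k := k) 0 1 1 (re_jet phi) (im_jet phi).
Proof.
move=> sphi; apply/funext => x; rewrite odd_liftE//.
by congr (_ +i* _); apply/esym; exact: mul1r.
Qed.

Lemma spectral_lift_pair p phi : k = p.*2.+3 -> smooth phi ->
  spectral_lift phi = pair_lift (k := k) p (spectral_const p) (- spectral_const p)
    (im_jet phi) (re_jet phi).
Proof.
move=> kE sphi; apply/funext => x; rewrite (spectral_liftE kE)//.
by congr (_ +i* _); apply/esym; exact: mulNr.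
Qed.

Lemma ddelta_linear j (t : R) c phi psi : smooth phi -> smooth psi ->
  ddelta j t (fun s => c * phi s + psi s) = c * ddelta j t phi + ddelta j t psi.
Proof. by move=> sphi spsi; rewrite /ddelta cpderiv_linear// mulrDr mulrCA. Qed.

Lemma odd_lift_linear c phi psi : smooth phi -> smooth psi ->
  odd_lift (k := k) (fun t => c * phi t + psi t) =
  (fun x => c * odd_lift phi x + odd_lift psi x).
Proof.
move=> sphi spsi; apply/funext => x; rewrite /odd_lift !ddelta_linear//.
by case: ifP => _; ring.
Qed.

Lemma spectral_lift_linear c phi psi : smooth phi -> smooth psi ->
  spectral_lift (k := k) (fun t => c * phi t + psi t) =
  (fun x => c * spectral_lift phi x + spectral_lift psi x).
Proof.
move=> sphi spsi; apply/funext => x; rewrite /spectral_lift ddelta_linear//.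
case: ifP => _; first by ring.
under eq_bigr => j _ do rewrite !ddelta_linear//.
rewrite (_ : \sum_(0 <= j < _) _ = c *
  (\sum_(0 <= j < (k - 3)./2.+1) (beta k j)%:C * (enorm x)%:C ^+ j
           * ((-1) ^+ j * ddelta j (enorm x) phi - ddelta j (- enorm x) phi)) +
  \sum_(0 <= j < (k - 3)./2.+1) (beta k j)%:C * (enorm x)%:C ^+ j
           * ((-1) ^+ j * ddelta j (enorm x) psi - ddelta j (- enorm x) psi)).
  by rewrite mulrDl mulrDr; congr (_ + _); ring.
by rewrite mulr_sumr -big_split/=; apply: eq_bigr => j _; ring.
Qed.

End LiftsAsPairs.

(** * The pairings as sums over the support *)

Section Pairings.
Context {R : realType} {k : nat}.
Implicit Types (A : set 'rV[R]_k) (c : 'rV[R]_k -> R[i]) (phi : 'rV[R]_1 -> R[i]).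

Lemma atomic_split0 A c (psi : 'rV[R]_k -> R[i]) (B : R) : locally_finite A ->
  (c 0 != 0 -> A 0) -> (forall x, B < enorm x -> psi x = 0) ->
  atomic_measure A c psi = c 0 * psi 0 + \sum_(x \in A `\ 0) c x * psi x.
Proof.
move=> lfA c0 psiB.
apply: (fsum_split0 (F := fun x => c x * psi x) lfA (@compact_enorm_ball R k B)).
  by move=> x /negP; rewrite -ltNge => /psiB ->; rewrite mulr0.
move=> A0; have [->|/c0//] := eqVneq (c 0) 0; by rewrite mul0r.
Qed.

Lemma sigma_odd_lift A c phi : locally_finite A -> (c 0 != 0 -> A 0) ->
  test_function phi -> sigma A c phi = atomic_measure A c (odd_lift phi).
Proof.
move=> lfA c0 tphi; have [B B0 [v1 v2]] := test_line_support tphi.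
have [j1 j2] := (line_jetP tphi.1.1, line_jetP tphi.1.2).
rewrite (atomic_split0 (B := B) lfA c0); last first.
  by move=> x Bx; rewrite (odd_lift_pair tphi.1); exact: (pair_lift_out _ _ _ B0 j1 j2 v1 v2).
have -> : odd_lift phi (0 : 'rV[R]_k) = - 2 * ddelta 1 0 phi by rewrite /odd_lift eqxx.
rewrite /sigma; congr (_ + _); first by ring.
apply: eq_fsbigr => x /set_mem[_ /eqP/negbTE x0].
by rewrite /odd_lift x0; ring.
Qed.

Lemma sigma_hat_spectral_lift p A c phi : k = p.*2.+3 -> locally_finite A ->
  (c 0 != 0 -> A 0) -> test_function phi ->
  sigma_hat A c phi = atomic_measure A c (spectral_lift phi).
Proof.
move=> kE lfA c0 tphi; have [B B0 [v1 v2]] := test_line_support tphi.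
have [j1 j2] := (line_jetP tphi.1.1, line_jetP tphi.1.2).
have out x : B < enorm x -> spectral_lift (k := k) phi x = 0.
  by move=> Bx; rewrite (spectral_lift_pair kE tphi.1); exact: (pair_lift_out _ _ _ B0 j2 j1 v2 v1).
rewrite (atomic_split0 (B := B) lfA c0 out).
have -> : spectral_lift phi (0 : 'rV[R]_k) = 2 * 'i%C * (alpha k)%:C * ddelta (k - 2) 0 phi.
  by rewrite /spectral_lift eqxx.
rewrite /sigma_hat -mulNr mulr_fsumr; congr (_ + _); first by ring.
apply: eq_fsbigr => x /set_mem[_ /eqP/negbTE x0].
by rewrite /spectral_lift x0; ring.
Qed.

End Pairings.

(** * Transfer to the line *)

Section Transfer.
Context {R : realType} {p : nat}.
Local Notation k := p.*2.+3.
Implicit Types (phi : 'rV[R]_1 -> R[i]) (u T : ('rV[R]_k -> R[i]) -> R[i]).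

(** The lift is linear and bounded for the Schwartz seminorms, so composition
    with it preserves continuity. *)
Lemma odd_lift_functional T : schwartz_functional T ->
  schwartz_functional (fun phi => T (odd_lift phi)).
Proof.
move=> [Tlin [N [C TC]]].
have slift phi : schwartz phi -> schwartz (odd_lift (k := k) phi).
  move=> sphi; have [s1 s2] := schwartz_jets sphi.
  by rewrite (odd_lift_pair sphi.1); exact: schwartz_pair_lift.
split=> [c phi psi sphi spsi|].
  by rewrite (odd_lift_linear _ sphi.1 spsi.1) Tlin//; exact: slift.
have [D D0 HD] := @pair_lift_bound R k 0 1 1 N.
exists (N.*2).+1, (C * D) => phi M sphi pM; have [b1 b2] := schwartz_bound_jets pM.
rewrite -mulrA; apply: TC; first exact: slift.
rewrite (odd_lift_pair sphi.1); apply: HD.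
- exact: line_jetP sphi.1.1.
- exact: line_jetP sphi.1.2.
- by apply: jet_bound_leq b1.
- by apply: jet_bound_leq b2.
Qed.

(** The lift maps functions supported in K to functions supported in a ball
    whose radius depends on K only. *)
Lemma spectral_lift_distribution u : Defs.distribution u ->
  Defs.distribution (fun phi => u (spectral_lift phi)).
Proof.
move=> [ulin ubound].
have tlift B phi : 0 <= B -> smooth phi -> jet_vanish B (re_jet phi) ->
    jet_vanish B (im_jet phi) -> test_function (spectral_lift (k := k) phi) /\
    fsupp (spectral_lift (k := k) phi) `<=` [set x | enorm x <= B].
  move=> B0 sphi v1 v2; rewrite (spectral_lift_pair erefl sphi).
  by apply: test_pair_lift => //; [exact: line_jetP sphi.2|exact: line_jetP sphi.1].
split=> [c phi psi tphi tpsi|K cK].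
  rewrite (spectral_lift_linear _ tphi.1 tpsi.1) ulin//.
  - have [B B0 [v1 v2]] := test_line_support tphi; exact: (tlift B phi B0 tphi.1 v1 v2).1.
  - have [B B0 [v1 v2]] := test_line_support tpsi; exact: (tlift B psi B0 tpsi.1 v1 v2).1.
have [B B0 HB] := line_support cK.
have [N [C uC]] := ubound _ (@compact_enorm_ball R k B).
have [D D0 HD] := @pair_lift_bound R k p (spectral_const p) (- spectral_const p) N.
exists (p.*2 + N.*2).+1, (C * (D * (1 + B) ^+ N.*2)) => phi M tphi pK pM.
have [v1 v2] := HB phi tphi.1 pK; have [tl sl] := tlift B phi B0 tphi.1 v1 v2.
have [b1 b2] := test_bound_jets N.*2 B0 v1 v2 pM.
rewrite -!mulrA; apply: uC => //; apply: schwartz_test_bound.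
rewrite (spectral_lift_pair erefl tphi.1); apply: HD => //.
- exact: line_jetP tphi.1.2.
- exact: line_jetP tphi.1.1.
Qed.

Lemma spectral_lift_test phi : test_function phi -> test_function (spectral_lift (k := k) phi).
Proof.
move=> tphi; have [B B0 [v1 v2]] := test_line_support tphi.
rewrite (spectral_lift_pair erefl tphi.1).
by apply: (test_pair_lift _ _ _ B0 (line_jetP tphi.1.2) (line_jetP tphi.1.1) v2 v1).1.
Qed.

Lemma odd_lift_test phi : test_function phi -> test_function (odd_lift (k := k) phi).
Proof.
move=> tphi; have [B B0 [v1 v2]] := test_line_support tphi.
rewrite (odd_lift_pair tphi.1).
by apply: (test_pair_lift _ _ _ B0 (line_jetP tphi.1.1) (line_jetP tphi.1.2) v1 v2).1.
Qed.

End Transfer.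

Theorem theorem5p1 (R : realType) (k : nat) (k_ge3 : (3 <= k)%N) (k_odd : odd k)
  (Lambda S : set 'rV[R]_k) (a b : 'rV[R]_k -> R[i])
  (suppa : forall x, Lambda x <-> a x != 0)
  (suppb : forall s, b s != 0 -> S s)
  (lfLambda : locally_finite Lambda)
  (lfS : locally_finite S)
  (mu_temperate : temperate (atomic_measure Lambda a))
  (mu_hat : fourier_transform (atomic_measure Lambda a) (atomic_measure S b)) :
  temperate (sigma Lambda a) /\
  fourier_transform (sigma Lambda a) (sigma_hat S b).
Proof.
have [p kE] : exists p, k = p.*2.+3.
  exists (k - 3)./2; rewrite halfK oddB// k_odd/=; lia.
subst k; have [_ [dS [T [sT Tmu] Tfourier]]] := mu_hat.
have sigmaE phi : test_function phi -> sigma Lambda a phi = atomic_measure Lambda a (odd_lift phi).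
  by apply: sigma_odd_lift => //; exact: (suppa 0).2.
have sigma_hatE phi : test_function phi ->
    sigma_hat S b phi = atomic_measure S b (spectral_lift phi).
  by apply: (sigma_hat_spectral_lift erefl) => //; exact: suppb.
have ext : temperate_extension (sigma Lambda a) (fun phi => T (odd_lift phi)).
  split; first exact: odd_lift_functional.
  by move=> phi tphi; rewrite sigmaE// Tmu//; exact: odd_lift_test.
have dsigma := temperate_extension_distribution ext.
have dhat : Defs.distribution (sigma_hat S b).
  have [dlin dbd] := spectral_lift_distribution dS; split.
    move=> c phi psi tphi tpsi; rewrite !sigma_hatE//; last exact: test_function_linear.
    exact: dlin.
  move=> K /dbd[N [C HC]]; exists N, C => phi M tphi pK pM.
  by rewrite sigma_hatE//; exact: HC.
split; first by split=> //; exists (fun phi => T (odd_lift phi)).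
do 2 split=> //; exists (fun phi => T (odd_lift phi)) => // phi tphi.
have [B B0 [v1 v2]] := test_line_support tphi.
rewrite sigma_hatE// Tfourier; last exact: spectral_lift_test.
congr T; apply/funext => xi.
exact: (fourier_spectral_lift B0 tphi.1 v1 v2).
Qed.
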